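(* Let $R$ be a ring, $X$ a non-empty set, and $\mathbb S=R[X^{\pm1};\boldsymbol\alpha]$ a skew Laurent polynomial ring of bijective type. Let $\mathcal T$ be a submonoid of the free abelian group $G_X$ and let $A=R[\mathcal T;\boldsymbol\alpha]=\bigoplus_{\tau\in\mathcal T}R\tau$ (a subring of $\mathbb S$). Then $\mathcal T$ is a denominator set for $A$ (a left and right Ore set of regular elements), and the subgroup $G=\mathcal T\mathcal T^{-1}$ of $G_X$ is a free abelian group having a basis $X'$ such that the ring of fractions of $A$ with respect to $\mathcal T$ is the skew Laurent polynomial ring of bijective type $\mathbb S'=\bigoplus_{g\in G}Rg=R[X'^{\pm1};\boldsymbol\alpha]$, and $$\operatorname{udim}(A)=\operatorname{udim}(\mathbb S')=\operatorname{udim}(R[X';\boldsymbol\alpha]),\qquad \mathcal Z(A)=\mathcal Z(R)\mathcal T,$$ where $R[X';\boldsymbol\alpha]=\bigoplus_{\tau\in T(X')}R\tau$ with $T(X')$ the submonoid of $G$ generated by $X'$. Moreover, if $R$ has enough uniform left ideals, then so does $A$, and $\operatorname{udim}(A)=\operatorname{udim}(R)$.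
   Context: Skew Laurent polynomial ring of bijective type: $X$ is a set of commuting variables, $G_X$ is the free abelian group on $X$ (its elements are the terms $x_1^{k_1}\cdots x_n^{k_n}$, $k_i\in\mathbb Z$), and $\mathbb S=R[X^{\pm1};\boldsymbol\alpha]$ is the ring which is a free left $R$-module with basis $G_X$, where terms multiply as in $G_X$ and, for each $x\in X$, there is a ring automorphism $\alpha_x$ of $R$ with $xa=\alpha_x(a)x$ and $x^{-1}a=\alpha_x^{-1}(a)x^{-1}$ for all $a\in R$, the automorphisms $\alpha_x$ pairwise commuting as required for this to be well defined; for $g\in G_X$, $\alpha_g$ denotes the corresponding composite automorphism, so $ga=\alpha_g(a)g$. For a subset $Z\subseteq R$ and a set of terms $\mathcal T$, $Z\mathcal T$ denotes the set of elements $\sum a_i\tau_i$ with $a_i\in Z$, $\tau_i\in\mathcal T$. $\operatorname{udim}$ of a ring is its left uniform dimension (possibly infinite cardinal); $\mathcal Z(B)$ is the left singular ideal of a ring $B$ (elements whose left annihilator contains an essential left ideal). A ring has enough uniform left ideals if every non-zero left ideal contains a uniform left ideal. *)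

(* Defs.v *)
From HB Require Import structures.
From mathcomp Require Import all_boot all_algebra.

Set Implicit Arguments.
Unset Strict Implicit.
Unset Printing Implicit Defensive.

Import GRing.Theory.
Local Open Scope ring_scope.

Definition psubset {T : Type} (A B : T -> Prop) : Prop := forall x, A x -> B x.

Definition is_Zbasis (G : zmodType) (H B : G -> Prop) : Prop :=
  psubset B H /\
  (forall h, H h -> exists n (b : 'I_n -> G) (k : 'I_n -> int),
       (forall i, B (b i)) /\ h = \sum_(i < n) (b i) *~ (k i)) /\
  (forall n (b : 'I_n -> G) (k : 'I_n -> int),
       injective b -> (forall i, B (b i)) ->
       \sum_(i < n) (b i) *~ (k i) = 0 -> forall i, k i = 0).

Definition is_submonoid (G : zmodType) (T : G -> Prop) : Prop :=
  T 0 /\ forall g h, T g -> T h -> T (g + h).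

Definition monoid_gen (G : zmodType) (B : G -> Prop) : G -> Prop :=
  fun g => exists s : seq G, (forall x, x \in s -> B x) /\ g = \sum_(x <- s) x.

Definition diff_group (G : zmodType) (T : G -> Prop) : G -> Prop :=
  fun g => exists t1 t2, T t1 /\ T t2 /\ g = t1 - t2.

Definition aut_action (R : pzRingType) (G : zmodType)
  (alpha : G -> {rmorphism R -> R}) : Prop :=
  (forall g, bijective (alpha g)) /\
  (forall a, alpha 0 a = a) /\
  (forall g h a, alpha (g + h) a = alpha g (alpha h a)).

Definition is_skew_group_ring (R : pzRingType) (G : zmodType)
  (alpha : G -> {rmorphism R -> R}) (S : pzRingType)
  (iota : {rmorphism R -> S}) (phi : G -> S) : Prop :=
  phi 0 = 1 /\
  (forall g h, phi (g + h) = phi g * phi h) /\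
  (forall g a, phi g * iota a = iota (alpha g a) * phi g) /\
  (forall s : S, exists n (a : 'I_n -> R) (g : 'I_n -> G),
       s = \sum_(i < n) iota (a i) * phi (g i)) /\
  (forall n (a : 'I_n -> R) (g : 'I_n -> G), injective g ->
       \sum_(i < n) iota (a i) * phi (g i) = 0 -> forall i, a i = 0).

Definition term_span (R : pzRingType) (G : zmodType) (S : pzRingType)
  (iota : {rmorphism R -> S}) (phi : G -> S) (Z : R -> Prop) (T : G -> Prop)
  : S -> Prop :=
  fun s => exists n (a : 'I_n -> R) (t : 'I_n -> G),
      (forall i, Z (a i) /\ T (t i)) /\ s = \sum_(i < n) iota (a i) * phi (t i).

Definition is_subring (S : pzRingType) (B : S -> Prop) : Prop :=
  B 1 /\ (forall x y, B x -> B y -> B (x - y)) /\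
  (forall x y, B x -> B y -> B (x * y)).

Definition left_ideal (S : pzRingType) (B L : S -> Prop) : Prop :=
  psubset L B /\ L 0 /\ (forall x y, L x -> L y -> L (x - y)) /\
  (forall b x, B b -> L x -> L (b * x)).

Definition nonzero (S : pzRingType) (L : S -> Prop) : Prop :=
  exists x, L x /\ x <> 0.

Definition essential_left_ideal (S : pzRingType) (B E : S -> Prop) : Prop :=
  left_ideal B E /\
  forall L, left_ideal B L -> nonzero L -> nonzero (fun x => L x /\ E x).

Definition left_singular (S : pzRingType) (B : S -> Prop) : S -> Prop :=
  fun s => B s /\ exists E, essential_left_ideal B E /\ forall e, E e -> e * s = 0.

Definition uniform_left_ideal (S : pzRingType) (B U : S -> Prop) : Prop :=
  left_ideal B U /\ nonzero U /\
  forall L1 L2, left_ideal B L1 -> left_ideal B L2 -> nonzero L1 -> nonzero L2 ->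
    psubset L1 U -> psubset L2 U -> nonzero (fun x => L1 x /\ L2 x).

Definition enough_uniform (S : pzRingType) (B : S -> Prop) : Prop :=
  forall L, left_ideal B L -> nonzero L ->
    exists U, uniform_left_ideal B U /\ psubset U L.

Definition has_indep (S : pzRingType) (B : S -> Prop) (I : Type) : Prop :=
  exists L : I -> S -> Prop,
    (forall i, left_ideal B (L i) /\ nonzero (L i)) /\
    (forall n (f : 'I_n -> I) (a : 'I_n -> S), injective f ->
       (forall k, L (f k) (a k)) -> \sum_(k < n) a k = 0 -> forall k, a k = 0).

Definition card_le (I J : Type) : Prop := exists f : I -> J, injective f.
Definition card_lt (I J : Type) : Prop := card_le I J /\ ~ card_le J I.

(* udim(B1) <= udim(B2), where udim is the supremum of the cardinalities of
   independent families of non-zero left ideals: kappa <= sup K iff every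
   lambda < kappa is < some member of K. *)
Definition udim_le (S1 S2 : pzRingType) (B1 : S1 -> Prop) (B2 : S2 -> Prop)
  : Prop :=
  forall I : Type, has_indep B1 I ->
  forall L : Type, card_lt L I -> exists J : Type, has_indep B2 J /\ card_lt L J.

Definition udim_eq (S1 S2 : pzRingType) (B1 : S1 -> Prop) (B2 : S2 -> Prop)
  : Prop := udim_le B1 B2 /\ udim_le B2 B1.

Definition denominator_set (S : pzRingType) (B D : S -> Prop) : Prop :=
  psubset D B /\ D 1 /\ (forall x y, D x -> D y -> D (x * y)) /\
  (forall d, D d -> forall b, B b -> (b * d = 0 -> b = 0) /\ (d * b = 0 -> b = 0)) /\
  (forall b d, B b -> D d -> exists b' d', B b' /\ D d' /\ d' * b = b' * d) /\
  (forall b d, B b -> D d -> exists b' d', B b' /\ D d' /\ b * d' = d * b').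

Definition ring_of_fractions (S : pzRingType) (B D Q : S -> Prop) : Prop :=
  is_subring Q /\ psubset B Q /\
  (forall d, D d -> exists u, Q u /\ u * d = 1 /\ d * u = 1) /\
  (forall q, Q q -> exists d u b, D d /\ u * d = 1 /\ d * u = 1 /\ B b /\ q = u * b) /\
  (forall q, Q q -> exists d u b, D d /\ u * d = 1 /\ d * u = 1 /\ B b /\ q = b * u).

(* Main.v *)
(* The group G_X is torsion-free, hence orderable, so that every element of S has
   a leading term.  For a non-zero f, a multiple r f of minimal support satisfies
   p (r f) = 0 <-> p a = 0 with a in R its leading coefficient; this makes A (r f)
   isomorphic to A a and reduces enough uniform left ideals of A to those of R,
   once A U is known to be uniform for U uniform in R.  If A U contained two
   independent left ideals A f and A g, then translating f and g by the finite
   set F_n of n-fold sums of their supports would embed 2 |F_n| independent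
   R-modules into a direct sum of |F_{n+1}| uniform ones, contradicting the
   polynomial growth of F_n.  For udim A <= udim R, a maximal independent family
   of uniform left ideals R k generates an essential left ideal of A, each member
   of an independent family in A meets a finite partial sum of it, and Hall's
   theorem for infinite families of finite sets yields an injection of index
   sets.  The singular ideal is computed on leading coefficients. *)
From HB Require Import structures.
From mathcomp Require Import all_boot all_algebra finmap zify boolp classical_sets.
Require Import Defs.

Set Implicit Arguments.
Unset Strict Implicit.
Unset Printing Implicit Defensive.

Import GRing.Theory.
Local Open Scope ring_scope.

(** [R] may have zero divisors, so a multiplier can kill the leading coefficient of [f] without
    killing [f]. Minimal support closes this gap for multipliers from all of [S], which makes
    [p f |-> p a] well defined and injective. The counting takes place over [R] because each
    [phi g U] is a uniform [R]-module; the factor 2 stands for the two families of translates, those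
    of [f] and those of [g]. The order on [G] only singles out leading terms and is unrelated to
    [T], which may contain elements of both signs. For the fractions, [T] and the monoid generated
    by [X'] have the same group of differences, so one localisation statement, used at both monoids,
    compares both uniform dimensions with that of the ring of fractions. The basis [X'] exists
    because subgroups of free abelian groups of any rank are free. *)

Lemma chain_seq (T : eqType) (C : set (set T)) (s : seq T) :
  total_on C subset -> (forall x, x \in s -> exists2 D, C D & D x) ->
  s = [::] \/ exists2 D, C D & forall x, x \in s -> D x.
Proof.
(* The empty list is a separate outcome because the chain itself may be empty and then offers no
   member. *)
move=> totC; elim: s => [|x s IH] hs; first by left.
right; have [D CD Dx] := hs x (mem_head _ _).
have [|->|[D' CD' D's]] := IH.
- by move=> y ys; apply: hs; rewrite inE ys orbT.
- by exists D => // y; rewrite inE => /eqP->.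
have [DD'|D'D] := totC _ _ CD CD'.
- by exists D' => // y; rewrite inE => /orP[/eqP->|/D's//]; apply: DD'.
- by exists D => // y; rewrite inE => /orP[/eqP->//|/D's]; apply: D'D.
Qed.

(** * Hall's theorem for infinite families of finite sets *)

Section Hall.
Variables (I K : choiceType) (F : I -> {fset K}).

Definition hall_condition (C : I -> {fset K}) : Prop :=
  forall J : {fset I}, (#|` J| <= #|` (\bigcup_(i <- J) C i)%fset|)%N.

Let remaining (D : set (I * K)) (i : I) : {fset K} :=
  [fset x in F i | ~~ `[< D (i, x) >]]%fset.

Let remainingP D i x :
  reflect (x \in F i /\ ~ D (i, x)) (x \in remaining D i).
Proof.
rewrite !inE /=; apply: (iffP andP) => -[h1 h2]; split=> //.
  by move: h2 => /asboolPn.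
by apply/asboolPn.
Qed.

Let bigfcup_seqP (C : I -> {fset K}) (J : {fset I}) x :
  reflect (exists2 i, i \in J & x \in C i) (x \in \bigcup_(i <- J) C i)%fset.
Proof.
apply: (iffP (bigfcupP _ _ _ _)) => [[i /andP[? _] ?]|[i ? ?]]; exists i => //.
by rewrite andbT.
Qed.

(* Rado's argument: remove as many pairs as possible; the submodularity of
   cardinality then forces every remaining set to be a singleton. *)
Theorem hall_transversal : hall_condition F ->
  exists2 f : I -> K, injective f & forall i, f i \in F i.
Proof.
move=> hF.
have [C CP totC|D [hD maxD]] :=
  @Zorn_bigcup _ (fun D : set (I * K) => hall_condition (remaining D)).
  move=> J; set D := (X in remaining X).
  (* Only finitely many pairs matter for a fixed [J], so those removed by the union are all removed
     by one member of the chain. *)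
  pose s := [seq p <- [seq (i, x) | i <- J, x <- F i] | `[< D p >]].
  have [p|s0|[D' CD' D's]] := @chain_seq _ C s totC.
  - by rewrite mem_filter => /andP[/asboolP[D' ? ?] _]; exists D'.
  - have -> : (\bigcup_(i <- J) remaining D i =
               \bigcup_(i <- J) F i)%fset; last exact: hF.
    apply/fsetP => x; apply/bigfcup_seqP/bigfcup_seqP => -[i iJ].
      by move=> /remainingP[? _]; exists i.
    move=> xF; exists i => //; apply/remainingP; split=> // Dix.
    suff: (i, x) \in s by rewrite s0.
    rewrite mem_filter; apply/andP; split; first exact/asboolP.
    by apply/allpairsPdep; exists i, x.
  - apply: leq_trans (CP _ CD' J) _; apply/fsubset_leq_card/fsubsetP => x.
    move=> /bigfcup_seqP[i iJ /remainingP[xF nD']].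
    apply/bigfcup_seqP; exists i => //; apply/remainingP; split=> // Dix.
    apply: nD'; apply: D's; rewrite mem_filter; apply/andP; split.
      exact/asboolP.
    by apply/allpairsPdep; exists i, x.
pose C := remaining D.
have ex1 i : exists x, x \in C i.
  have := hD [fset i]%fset; rewrite cardfs1 big_seq_fset1 cardfs_gt0.
  by case/fset0Pn => x xC; exists x.
(* By maximality, removing [(i, x)] breaks the condition at some [J0], which must contain [i]; [J]
   is [J0] without [i], and the strict inequality absorbs the lost unit. *)
have tight i x : x \in C i -> exists2 J : {fset I}, i \notin J &
    (#|` (\bigcup_(j <- J) C j) `|` (C i `\ x)| <= #|` J|)%fset%N.
  move=> xC.
  have /existsNP[J0 /negP] : ~ hall_condition (remaining (D `|` [set (i, x)])).
    apply: maxD; split; first by move=> p; left.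
    move=> /(_ (i, x)) h; have /remainingP[_] := xC; apply; apply: h.
    by right.
  rewrite -ltnNge => ltJ0.
  have CE j : j != i -> remaining (D `|` [set (i, x)]) j = C j.
    move=> ji; apply/fsetP=> y; apply/remainingP/remainingP => -[yF nD].
      by split=> // ?; apply: nD; left.
    by split=> // -[//|[ij]]; move: ji; rewrite ij eqxx.
  have CiE : remaining (D `|` [set (i, x)]) i = (C i `\ x)%fset.
    apply/fsetP=> y; rewrite in_fsetD1; apply/remainingP/andP.
      move=> [yF nD]; split.
        by apply/eqP => yx; apply: nD; right; rewrite yx.
      by apply/remainingP; split=> // ?; apply: nD; left.
    move=> [/eqP yx /remainingP[yF nD]]; split=> // -[//|[]].
    by move/yx.
  have [iJ0|iJ0] := boolP (i \in J0); last first.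
    have := hD J0; rewrite leqNgt.
    rewrite [X in (#|` X|)%N](_ : _ =
      (\bigcup_(j <- J0) remaining (D `|` [set (i, x)]) j)%fset) ?ltJ0 //.
    rewrite big_seq [RHS]big_seq; apply: eq_bigr => j jJ0; rewrite CE //.
    by apply: contraNneq iJ0 => <-.
  exists (J0 `\ i)%fset; first by rewrite in_fsetD1 eqxx.
  move: ltJ0; rewrite (cardfsD1 i J0) iJ0 add1n ltnS; apply: leq_trans.
  apply/fsubset_leq_card/fsubsetP => y; rewrite in_fsetU => /orP[].
    move=> /bigfcup_seqP[j]; rewrite in_fsetD1 => /andP[ji jJ0] yC.
    by apply/bigfcup_seqP; exists j => //; rewrite CE.
  by move=> yC; apply/bigfcup_seqP; exists i => //; rewrite CiE.
(* For [x <> y] the union of the two tight sets contains all of [C i], so it has more elements than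
   the union of [J1] and [J2]; their intersection has at least as many as that of [J1] and [J2]. The
   sum then exceeds the two tight bounds. *)
have uniqC i x y : x \in C i -> y \in C i -> x = y.
  move=> xC yC; apply/eqP/negPn/negP => xy.
  have [J1 iJ1 l1] := tight i x xC; have [J2 iJ2 l2] := tight i y yC.
  set P := (X in (#|` X| <= _)%N) in l1; set Q := (X in (#|` X| <= _)%N) in l2.
  have := leq_add l1 l2; rewrite -[(#|` P| + _)%N]cardfsUI leqNgt => /negP; apply.
  rewrite -cardfsUI addnC -addnS addnC; apply: leq_add; last first.
    apply: leq_trans (hD _) _; apply/fsubset_leq_card/fsubsetP => z.
    move=> /bigfcup_seqP[j]; rewrite in_fsetI => /andP[j1 j2] zC.
    rewrite in_fsetI !in_fsetU.
    by apply/andP; split; apply/orP; left; apply/bigfcup_seqP; exists j.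
  have -> : (#|` (J1 `|` J2)%fset|.+1 = #|` (i |` (J1 `|` J2))%fset|)%N.
    by rewrite cardfsU1 in_fsetU negb_or iJ1 iJ2.
  apply: leq_trans (hD _) _; apply/fsubset_leq_card/fsubsetP => z.
  move=> /bigfcup_seqP[j]; rewrite 2!in_fsetU in_fset1.
  rewrite !in_fsetU !in_fsetD1 => jJ zC.
  case/orP: jJ => [/eqP ji|/orP[jJ|jJ]].
  - have [zx|zx] := eqVneq z x; last by rewrite -ji zC /= orbT.
    by rewrite zx xy xC /= !orbT.
  - by do 2!(apply/orP; left); apply/bigfcup_seqP; exists j.
  - by apply/orP; right; apply/orP; left; apply/bigfcup_seqP; exists j.
have [f fC] := choice ex1.
exists f => [i j fij|i]; last by have /remainingP[] := fC i.
apply/eqP/negPn/negP => ij.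
have := hD [fset i; j]%fset; rewrite cardfs2 ij leqNgt => /negP; apply.
rewrite ltnS /= -(cardfs1 (f i)); apply/fsubset_leq_card/fsubsetP => x.
move=> /bigfcup_seqP[k]; rewrite in_fset2 in_fset1 => /orP[/eqP->|/eqP->] xC.
  by rewrite (uniqC _ _ _ xC (fC i)).
by rewrite fij (uniqC _ _ _ xC (fC j)).
Qed.

End Hall.

(** * Integral spans and bases of abelian groups *)

Section FreeAbelian.
Variable G : zmodType.
Implicit Types (X Y B H : G -> Prop) (g h x y b : G).

Inductive zspan Y : G -> Prop :=
| zspan0 : zspan Y 0
| zspan_cons b g (k : int) : Y b -> zspan Y g -> zspan Y (g + b *~ k).

Lemma zspanD Y g h : zspan Y g -> zspan Y h -> zspan Y (g + h).
Proof.
move=> Yg; elim=> [|b h' k Yb _ IH]; first by rewrite addr0.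
by rewrite addrA; apply: zspan_cons.
Qed.

Lemma zspanMz Y g (m : int) : zspan Y g -> zspan Y (g *~ m).
Proof.
elim=> [|b h k Yb _ IH]; first by rewrite mul0rz; apply: zspan0.
by rewrite mulrzDl -mulrzA; apply: zspan_cons.
Qed.

Lemma zspanB Y g h : zspan Y g -> zspan Y h -> zspan Y (g - h).
Proof. by move=> Yg Yh; apply: zspanD => //; rewrite -mulrN1z; apply: zspanMz. Qed.

Lemma zspan_gen Y b : Y b -> zspan Y b.
Proof.
by move=> Yb; rewrite -[b]add0r -[b]mulr1z; apply: zspan_cons => //; apply: zspan0.
Qed.

Lemma zspan_sub Y H g : H 0 -> (forall a b, H a -> H b -> H (a - b)) ->
  psubset Y H -> zspan Y g -> H g.
Proof.
move=> H0 HB YH.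
have HN a : H a -> H (- a) by move=> Ha; rewrite -sub0r; apply: HB.
have HD a b : H a -> H b -> H (a + b).
  by move=> Ha Hb; rewrite -[b]opprK; apply/HB/HN.
have Hn a n : H a -> H (a *+ n).
  by move=> Ha; elim: n => [|n IH]; rewrite ?mulr0n // mulrS; apply: HD.
elim=> // b h k /YH Hb _ Hh; apply: HD => //.
by case: k => n; [apply: Hn|rewrite NegzE mulrNz; apply/HN/Hn].
Qed.

Lemma zspan_mono Y Y' g : psubset Y Y' -> zspan Y g -> zspan Y' g.
Proof.
move=> YY'; apply: zspan_sub; first exact: zspan0.
  by move=> a b; apply: zspanB.
by move=> y /YY'; apply: zspan_gen.
Qed.

Lemma zspan_sum Y (I : eqType) (r : seq I) (F : I -> G) (c : I -> int) :
  (forall i, i \in r -> zspan Y (F i)) -> zspan Y (\sum_(i <- r) F i *~ c i).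
Proof.
move=> YF; rewrite big_seq; apply: (big_ind (zspan Y)).
- exact: zspan0.
- by move=> a b; apply: zspanD.
- by move=> i /YF; apply: zspanMz.
Qed.

Lemma zspan_seq Y g : zspan Y g -> exists (s : seq G) (c : G -> int),
  [/\ uniq s, forall y, y \in s -> Y y & g = \sum_(y <- s) y *~ c y].
Proof.
elim=> [|b h k Yb _ [s [c [us sY ->]]]].
  by exists [::], (fun=> 0); split=> //; rewrite big_nil.
have [bs|bs] := boolP (b \in s).
  exists s, (fun y => if y == b then c y + k else c y); split=> //.
  rewrite (bigD1_seq b) //= [RHS](bigD1_seq b) //= eqxx mulrzDr addrAC.
  by congr (_ + _); apply: eq_bigr => y /negPf->.
exists (b :: s), (fun y => if y == b then k else c y); split=> //=.
- by rewrite bs.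
- by move=> y; rewrite inE => /orP[/eqP->//|]; apply: sY.
rewrite big_cons eqxx addrC; congr (_ + _); apply: eq_big_seq => y ys.
by case: eqP => // yb; rewrite -yb ys in bs.
Qed.

Definition zindep B : Prop := forall (s : seq G) (c : G -> int), uniq s ->
  (forall y, y \in s -> B y) -> \sum_(y <- s) y *~ c y = 0 ->
  forall y, y \in s -> c y = 0.

Lemma is_ZbasisP H B : is_Zbasis H B <->
  [/\ psubset B H, forall h, H h -> zspan B h & zindep B].
Proof.
split=> [[BH [spB indB]]|[BH spB indB]].
  split=> // [h /spB[n [b [k [Bb ->]]]]|s c us sB e y ys].
    by apply: zspan_sum => i _; apply/zspan_gen/Bb.
  pose b (i : 'I_(size s)) := nth 0 s i.
  have bI : injective b.
    by move=> i j /eqP; rewrite nth_uniq // => /eqP/val_inj.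
  have iy : (index y s < size s)%N by rewrite index_mem.
  have -> : y = b (Ordinal iy) by rewrite /b /= nth_index.
  apply: (indB _ b (c \o b)) => // [i|]; first by apply/sB/mem_nth.
  by rewrite -[RHS]e (big_nth 0) big_mkord.
split=> //; split=> [h /spB/zspan_seq[s [c [us sB ->]]]|n b k bI Bb e i].
  exists (size s), (fun i => nth 0 s i), (fun i => c (nth 0 s i)); split.
    by move=> i; apply/sB/mem_nth.
  by rewrite (big_nth 0) big_mkord.
(* Injectivity of [b] carries the coefficients from indices to group elements; the default 0 off the
   image of [b] never enters the sum. *)
pose c y := if [pick j | b j == y] is Some j then k j else 0.
have cE j : c (b j) = k j.
  rewrite /c; case: pickP => [j' /eqP/bI->//|/(_ j)]; by rewrite eqxx.
rewrite -cE; apply: (indB [seq b j | j <- enum 'I_n] c).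
- by rewrite map_inj_uniq ?enum_uniq.
- by move=> y /mapP[j _ ->].
- by rewrite big_map big_enum /= -[RHS]e; apply: eq_bigr => j _; rewrite cE.
- by rewrite map_f ?mem_enum.
Qed.

Lemma zbasis_torsion_free X : is_Zbasis (fun=> True) X ->
  forall g n, g *+ n.+1 = 0 -> g = 0.
Proof.
case/is_ZbasisP=> _ spX indX g n gn0.
have [s [c [us sX ge]]] := zspan_seq (spX g I).
rewrite ge big_seq big1 // => y ys.
suff -> : c y = 0 by rewrite mulr0z.
have := indX s (fun y => c y * n.+1%:Z) us sX _ y ys.
have -> : \sum_(y <- s) y *~ (c y * n.+1%:Z) = 0.
  by rewrite -[RHS]gn0 ge -sumrMnl; apply: eq_bigr => z _; rewrite mulrzA.
by move=> /(_ erefl)/eqP; rewrite mulf_eq0 orbF => /eqP.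
Qed.

End FreeAbelian.

(** * Subgroups of free abelian groups are free *)

Section SubgroupFree.
Variable G : zmodType.
Implicit Types (X Y B H : G -> Prop).

(** Division with remainder by the least positive member. The zero subgroup is covered by [d = 0], a
    case that the application keeps apart. *)
Lemma int_subgroup_principal (J : int -> Prop) :
  J 0 -> (forall a b, J a -> J b -> J (a - b)) ->
  exists2 d, J d & forall k, J k -> exists q, k = q * d.
Proof.
move=> J0 JB.
have Jspan k (m : int) : J k -> J (m * k).
  move=> Jk; rewrite mulrC -mulrzz.
  apply: (zspan_sub J0 JB (Y := eq k)) => [_ <-//|].
  exact/zspanMz/zspan_gen.
have [h|/existsNP[k0 /not_implyP[Jk0 /eqP nk0]]] := pselect (forall k, J k -> k = 0).
  by exists 0 => // k /h->; exists 0; rewrite mul0r.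
have ex : exists n, `[< J n.+1%:Z >].
  exists `|k0|.-1; apply/asboolP; rewrite prednK ?absz_gt0 // abszEsg.
  exact: Jspan.
case: (ex_minnP ex) => n /asboolP Jn minn; exists n.+1%:Z => // k Jk.
exists (k %/ n.+1%:Z)%Z; rewrite {1}(divz_eq k n.+1%:Z).
suff -> : (k %% n.+1%:Z)%Z = 0 by rewrite addr0.
have Jr : J (k %% n.+1%:Z)%Z by rewrite /modz; apply/JB/Jspan.
have := modz_ge0 k (isT : n.+1%:Z != 0).
have := ltz_pmod k (isT : 0 < n.+1%:Z).
case: (k %% n.+1%:Z)%Z Jr => // -[//|m] Jm; rewrite ltz_nat => mn _.
by have := minn m; rewrite leqNgt -ltnS mn => h; have := h (asboolT Jm).
Qed.

Let tY (Z : set (bool * G)) g := Z (true, g).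
Let tB (Z : set (bool * G)) g := Z (false, g).

Let partial_basis X H (Z : set (bool * G)) : Prop :=
  [/\ psubset (tY Z) X, forall b, tB Z b -> H b /\ zspan (tY Z) b,
      forall h, H h -> zspan (tY Z) h -> zspan (tB Z) h & zindep (tB Z)].

(* Zorn's lemma is applied to pairs (Y, B) with Y a part of X and B a basis of
   the intersection of H with the span of Y, encoded as one subset of
   bool * G so that the order is inclusion. *)
Theorem subgroup_free X H : is_Zbasis (fun=> True) X ->
  H 0 -> (forall a b, H a -> H b -> H (a - b)) ->
  exists B, is_Zbasis H B.
Proof.
case/is_ZbasisP=> _ spX indX H0 HB.
have [C CP totC|Z [[YX BHY HYB indB] maxZ]] :=
    @Zorn_bigcup _ (partial_basis X H).
  set U := (\bigcup_(_ in _) _)%classic.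
  have sup (D : set (bool * G)) p : C D -> D p -> U p by move=> CD Dp; exists D.
  have chain b (s : seq G) : (forall y, y \in s -> U (b, y)) ->
      s = [::] \/ exists2 D, C D & forall y, y \in s -> D (b, y).
    move=> sU; have [p /mapP[y ys ->]|s0|[D CD h]] :=
        @chain_seq _ C [seq (b, y) | y <- s] totC.
    - by have [D ? ?] := sU y ys; exists D.
    - by left; case: (s) s0.
    - by right; exists D => // y ys; apply/h/map_f.
  split.
  - by move=> y [D CD Dy]; have [h _ _ _] := CP _ CD; apply: h.
  - move=> b [D CD Db]; have [_ h _ _] := CP _ CD; have [Hb spb] := h _ Db.
    by split=> //; apply: zspan_mono spb => y; apply: sup.
  - move=> h Hh /zspan_seq[s [c [us sY he]]].
    have [s0|[D CD sD]] := chain true s sY.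
      by rewrite he s0 big_nil; apply: zspan0.
    have [_ _ spD _] := CP _ CD.
    apply: (@zspan_mono _ (tB D)); first by move=> y; apply: sup.
    by apply: spD => //; rewrite he; apply: zspan_sum => y /sD; apply: (@zspan_gen _ (tY D)).
  - move=> s c us sB; have [->//|[D CD sD]] := chain false s sB.
    by have [_ _ _ h] := CP _ CD; apply: h.
exists (tB Z); apply/is_ZbasisP; split=> // [b /BHY[]//|h Hh].
apply: (HYB) => //; apply: zspan_mono (spX h I) => x Xx.
apply: contrapT => nYx.
have xfree (k : int) : zspan (tY Z) (x *~ k) -> k = 0.
  move=> /zspan_seq[s [c [us sY xk]]]; apply: oppr_inj; rewrite oppr0.
  have xs : x \notin s by apply/negP => /sY.
  have := indX (x :: s) (fun y => if y == x then - k else c y).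
  rewrite /= xs => /(_ us _ _ x (mem_head _ _)); rewrite eqxx; apply.
    by move=> y; rewrite inE => /orP[/eqP->//|/sY/YX].
  rewrite big_cons eqxx mulrNz xk.
  rewrite [X in _ + X](_ : _ = \sum_(y <- s) y *~ c y) ?addNr //.
  by apply: eq_big_seq => y ys; case: eqP => // yx; rewrite -yx ys in xs.
(* The [x]-coordinates of the members of [H] in the span of Y and [x] form a group generated by [d],
   and [h0] realises [d]. The enlarged pair adds [x] to Y, and [h0] to B only when [d <> 0]. *)
have [||d [g0 Yg0 Hd] dP] :=
    @int_subgroup_principal (fun k => exists2 g, zspan (tY Z) g & H (g + x *~ k)).
- by exists 0; [apply: zspan0|rewrite mulr0z addr0].
- move=> k l [g Yg Hg] [g' Yg' Hg']; exists (g - g'); first exact: zspanB.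
  by rewrite mulrzBr addrACA -opprD; apply: HB.
set h0 := g0 + x *~ d in Hd.
pose Z' p := Z p \/ p = (true, x) \/ (p = (false, h0) /\ d <> 0).
have YZ' : psubset (tY Z) (tY Z') by move=> y; left.
have Yx : tY Z' x by right; left.
have h0Y (k : int) : zspan (tY Z) (h0 *~ k) -> k * d = 0.
  rewrite /h0 mulrzDl -mulrzA => hs; apply: xfree; rewrite mulrC.
  rewrite -[_ *~ _](addKr (g0 *~ k)) addrC; apply: zspanB => //.
  exact: zspanMz.
case: (maxZ Z') => [|].
  split; first by move=> p; left.
  by move=> /(_ (true, x) Yx).
split.
- by move=> y [/YX//|[[->]//|[]]].
- move=> b [/BHY[Hb Yb]|[//|[[->] _]]].
    by split=> //; apply: zspan_mono Yb.
  split=> //; apply: zspan_cons => //; exact: zspan_mono Yg0.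
- move=> h1 Hh1 Y'h1.
  have [k [g Yg h1e]] : exists k, exists2 g, zspan (tY Z) g & h1 = g + x *~ k.
    elim: Y'h1 {Hh1} => [|y g k Yy _ [l [g1 Yg1 ->]]].
      by exists 0, 0; [exact: zspan0|rewrite mulr0z addr0].
    case: Yy => [Yy|[[->]|[]//]].
      exists l, (g1 + y *~ k); last by rewrite addrAC.
      exact: zspan_cons.
    by exists (l + k), g1 => //; rewrite mulrzDr addrA.
  have [|q kq] := dP k; first by exists g; rewrite -?h1e.
  have BB' : psubset (tB Z) (tB Z') by move=> y; left.
  (* Subtracting [q] copies of [h0] cancels the [x]-coordinate and leaves an element of [H] in the
     old span. *)
  have h1B : zspan (tB Z) (h1 - h0 *~ q).
    apply: (HYB).
      by apply: (zspan_sub H0 HB (Y := H)) => //; apply: zspanB;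
        [|apply: zspanMz]; apply: zspan_gen.
    rewrite h1e kq /h0 mulrzDl -mulrzA [d * q]mulrC [g0 *~ q + _]addrC addrKA.
    by apply: zspanB => //; apply: zspanMz.
  have [d0|nd0] := pselect (d = 0).
    apply: zspan_mono BB' _; apply: HYB => //.
    by rewrite h1e kq d0 mulr0 mulr0z addr0.
  rewrite -(subrK (h0 *~ q) h1); apply: zspan_cons; first by right; right.
  exact: zspan_mono BB' h1B.
- move=> s c us sB' e.
  have h0s y : y \in s -> y <> h0 -> tB Z y.
    by move=> /sB'[//|[//|[[->]]]].
  (* The other members of the relation lie in the old span, so the [x]-coordinate [c h0 * d] must
     vanish. *)
  have ch0 : h0 \in s -> d <> 0 -> c h0 = 0.
    move=> h0in /eqP/negPf d0; move: e; rewrite (bigD1_seq h0) //= => /eqP.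
    rewrite addr_eq0 => /eqP e; have: c h0 * d = 0.
      apply: h0Y; rewrite e -[- _]sub0r; apply: zspanB; first exact: zspan0.
      rewrite big_seq_cond; apply: (big_ind (zspan (tY Z))).
      + exact: zspan0.
      + by move=> *; apply: zspanD.
      + move=> y /andP[ys /eqP yh]; apply: zspanMz.
        by have [] := BHY y (h0s y ys yh).
    by move=> /eqP; rewrite mulf_eq0 d0 orbF => /eqP.
  have [d0|nd0] := pselect (d = 0).
    by apply: indB => // y /sB'[//|[//|[_ /(_ d0)]]].
  have e' : \sum_(y <- [seq y <- s | y != h0]) y *~ c y = 0.
    rewrite big_filter; have [h0in|h0n] := boolP (h0 \in s).
      by move: e; rewrite (bigD1_seq h0) //= ch0 // mulr0z add0r.
    rewrite -[RHS]e big_seq_cond [RHS]big_seq; apply: eq_bigl => y.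
    by case ys: (y \in s) => //=; apply/eqP => yh; rewrite -yh ys in h0n.
  move=> y ys; have [yh|yh] := eqVneq y h0; first by rewrite yh ch0 // -yh.
  apply: (indB _ _ _ _ e'); first exact: filter_uniq.
    by move=> z; rewrite mem_filter => /andP[/eqP zh zs]; apply: h0s.
  by rewrite mem_filter yh.
Qed.

End SubgroupFree.

(** * Orderings of torsion-free abelian groups *)

Definition positive_cone (G : zmodType) (P : G -> Prop) : Prop :=
  ~ P 0 /\ forall a b, P a -> P b -> P (a + b).

(** An element [g <> 0] outside a maximal cone [P] cannot be adjoined, so a negative multiple of [g]
    is already in [P]; torsion-freeness excludes the other way of reaching 0. If both [g0] and
    [- g0] were outside, [P] would contain a positive and a negative multiple of [g0], and suitable
    multiples of these add up to 0. *)
Theorem torsion_free_orderable (G : zmodType) :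
  (forall (g : G) n, g *+ n.+1 = 0 -> g = 0) ->
  exists2 P : G -> Prop, positive_cone P & forall g, g <> 0 -> P g \/ P (- g).
Proof.
move=> tf.
have [C CP totC|P [[nP0 PD] maxP]] := @Zorn_bigcup _ (@positive_cone G).
  split=> [[D /CP[n0 _] /n0//]|a b [D CD Da] [D' CD' D'b]].
  have [DD'|D'D] := totC _ _ CD CD'.
    by exists D' => //; have [_ h] := CP _ CD'; apply: h => //; apply: DD'.
  by exists D => //; have [_ h] := CP _ CD; apply: h => //; apply: D'D.
exists P => // g0 ng0; apply: contrapT => /not_orP[nPg nPNg].
have Pn g n : P g -> P (g *+ n.+1).
  by move=> Pg; elim: n => // n IH; rewrite mulrS; apply: PD.
have ext g : g <> 0 -> ~ P g -> exists n, P (- (g *+ n.+1)).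
  move=> nzg ng; apply: contrapT => /forallNP nP.
  pose P0 p := P p \/ p = 0.
  have P0D p q : P0 p -> P0 q -> P0 (p + q).
    move=> [Pp|->] [Pq|->]; rewrite ?add0r ?addr0; by [left; apply: PD|left|right].
  pose P' a := P a \/ exists2 p, P0 p & exists n, a = p + g *+ n.+1.
  case: (maxP P'); last split.
  - split; first by move=> a; left.
    move=> /(_ g) h; apply: ng; apply: h; right; exists 0; first by right.
    by exists 0%N; rewrite add0r.
  - move=> [//|[p P0p [n /eqP]]]; rewrite eq_sym addr_eq0 => /eqP e.
    case: P0p => [Pp|p0]; first by apply: (nP n); rewrite -e.
    by apply/nzg/(tf _ n)/oppr_inj; rewrite -e p0 oppr0.
  - move=> a b [Pa|[p P0p [n ->]]] [Pb|[q P0q [m ->]]].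
    + by left; apply: PD.
    + by right; exists (a + q); [apply: P0D => //; left|exists m; rewrite addrA].
    + right; exists (p + b); [by apply: P0D => //; left|].
      by exists n; rewrite addrAC.
    + right; exists (p + q); [exact: P0D|exists (n + m).+1].
      by rewrite addrACA -mulrnDr addSn addnS.
have [n Pn1] := ext g0 ng0 nPg.
have [|m Pm1] := ext (- g0) _ nPNg; first by move/eqP; rewrite oppr_eq0 => /eqP.
have h1 := Pn _ m Pn1; have h2 := Pn _ n Pm1.
apply: nP0; have := PD _ _ h1 h2.
by rewrite [- g0 *+ _]mulNrn opprK mulNrn -!mulrnA mulnC addNr.
Qed.

(** * Polynomial growth of iterated sumsets *)

Section Growth.
Variables (G : zmodType) (K : seq G).

Fixpoint sumset (n : nat) : seq G :=
  if n is n'.+1 then undup [seq x + k | x <- sumset n', k <- K] else [:: 0].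

Lemma sumset_uniq n : uniq (sumset n).
Proof. by case: n => // n; apply: undup_uniq. Qed.

Lemma sumset_step n x k : x \in sumset n -> k \in K -> x + k \in sumset n.+1.
Proof.
by move=> xF kK; rewrite /= mem_undup; apply/allpairsPdep; exists x, k.
Qed.

Lemma sumset_closed (T : G -> Prop) n x : is_submonoid T ->
  (forall k, k \in K -> T k) -> x \in sumset n -> T x.
Proof.
move=> [T0 TD] KT; elim: n x => [|n IH] x; first by rewrite inE => /eqP->.
rewrite /= mem_undup => /allpairsPdep[y [k [yF kK ->]]].
by apply: TD; [apply: IH|apply: KT].
Qed.

(** An [n]-fold sum is determined by how often each position of [K] is used, at most [n] times
    each. *)
Lemma size_sumset n : (size (sumset n) <= n.+1 ^ size K)%N.
Proof.
pose val (c : {ffun 'I_(size K) -> 'I_n.+1}) := \sum_(i < size K) K`_i *+ c i.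
have := @uniq_leq_size _ (sumset n) (codom val) (sumset_uniq n).
rewrite size_codom card_ffun !card_ord; apply=> x xF.
suff [c cn ->] : exists2 c : 'I_(size K) -> nat,
    forall i, (c i <= n)%N & x = \sum_(i < size K) K`_i *+ c i.
  apply/codomP; exists [ffun i => inord (c i)]; apply: eq_bigr => i _.
  by rewrite ffunE inordK // ltnS.
elim: n x xF {val} => [|n IH] x.
  rewrite inE => /eqP->; exists (fun=> 0%N) => //.
  by rewrite big1 // => i _; rewrite mulr0n.
rewrite /= mem_undup => /allpairsPdep[y [k [/IH[c cn ->] kK ->]]].
have ik : (index k K < size K)%N by rewrite index_mem.
exists (fun i => c i + (i == Ordinal ik))%N => [i|].
  by rewrite -addn1 leq_add ?leq_b1.
under [RHS]eq_bigr do rewrite mulrnDr.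
rewrite big_split /=; congr (_ + _).
rewrite (bigD1 (Ordinal ik)) //= eqxx mulr1n nth_index // big1 ?addr0 //.
by move=> i /negPf->; rewrite mulr0n.
Qed.

Lemma exp2_gt_pow k : exists n, (n.+1 ^ k < 2 ^ n)%N.
Proof.
(* With [n + 1 = 2 ^ (2j)] the claim reads [2jk < 2 ^ (2j) - 1]; as [j = 2k + 2], it follows from
   [(j + 1) ^ 2 <= 2 ^ (2j)]. *)
pose j := k.+1.*2; exists (2 ^ (j + j)).-1.
rewrite prednK ?expn_gt0 // -expnM ltn_exp2l // -ltnS prednK ?expn_gt0 //.
have h : (j.+1 * j.+1 <= 2 ^ (j + j))%N by rewrite expnD leq_mul // ltn_expl.
by apply: leq_trans h; rewrite /j; nia.
Qed.

(** Sizes that at least double at every step would reach [2 ^ n], beyond the polynomial bound. *)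
Lemma sumset_small_doubling :
  exists n, (size (sumset n.+1) < 2 * size (sumset n))%N.
Proof.
apply: contrapT => /forallNP h.
have h2 n : (2 ^ n <= size (sumset n))%N.
  elim: n => // n IH; rewrite expnS; have /negP := h n; rewrite -leqNgt.
  by apply: leq_trans; rewrite leq_mul2l IH orbT.
have [n] := exp2_gt_pow (size K).
by rewrite ltnNge (leq_trans (h2 n) (size_sumset n)).
Qed.

End Growth.

(** * Exchange for direct sums of uniform submodules *)

Section Exchange.
Variables (S : pzRingType) (B : S -> Prop).
Implicit Types L U V : S -> Prop.

(** Containment in [B] is left out so that one notion covers left ideals of [A] and [R]-submodules
    of [S], the latter with [B] the image of [R]. *)
Definition submodule L : Prop :=
  L 0 /\ (forall x y, L x -> L y -> L (x - y)) /\
  (forall b x, B b -> L x -> L (b * x)).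

Definition uniform_submodule U : Prop :=
  forall L1 L2, submodule L1 -> submodule L2 -> nonzero L1 -> nonzero L2 ->
    psubset L1 U -> psubset L2 U -> nonzero (fun x => L1 x /\ L2 x).

Definition independent n (V : 'I_n -> S -> Prop) : Prop :=
  forall a : 'I_n -> S, (forall k, V k (a k)) ->
    \sum_(k < n) a k = 0 -> forall k, a k = 0.

Definition sum_submodule n (V : 'I_n -> S -> Prop) (s : S) : Prop :=
  exists2 v : 'I_n -> S, forall j, V j (v j) & s = \sum_(j < n) v j.

Lemma submoduleN L x : submodule L -> L x -> L (- x).
Proof. by move=> [L0 [LB _]] Lx; rewrite -sub0r; apply: LB. Qed.

Lemma submoduleD L x y : submodule L -> L x -> L y -> L (x + y).
Proof.
move=> sL Lx Ly; rewrite -[y]opprK; have [_ [LB _]] := sL; apply: LB => //.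
exact: submoduleN.
Qed.

Lemma submodule_sum L (I : eqType) (r : seq I) (F : I -> S) :
  submodule L -> (forall i, i \in r -> L (F i)) -> L (\sum_(i <- r) F i).
Proof.
move=> sL LF; rewrite big_seq; apply: (big_ind L) => //; first by case: sL.
by move=> x y; apply: submoduleD.
Qed.

Lemma submodule_sum_submodule n (V : 'I_n -> S -> Prop) :
  (forall j, submodule (V j)) -> submodule (sum_submodule V).
Proof.
move=> sV; split; [|split].
- by exists (fun=> 0) => [j|]; [case: (sV j)|rewrite big1].
- move=> x y [v Vv ->] [w Vw ->]; exists (fun j => v j - w j); last by rewrite sumrB.
  by move=> j; case: (sV j) => _ [h _]; apply: h.
- move=> b x Bb [v Vv ->]; exists (fun j => b * v j); last by rewrite mulr_sumr.
  by move=> j; case: (sV j) => _ [_ h]; apply: h.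
Qed.

Lemma submoduleI L L' : submodule L -> submodule L' ->
  submodule (fun x => L x /\ L' x).
Proof.
move=> [L0 [LB LM]] [L0' [LB' LM']]; split=> //; split.
  by move=> x y [? ?] [? ?]; split; [apply: LB|apply: LB'].
by move=> b x Bb [? ?]; split; [apply: LM|apply: LM'].
Qed.

Lemma independent_lift n (V : 'I_n.+1 -> S -> Prop) i0 z (y : 'I_n -> S) :
  independent V -> V i0 z -> (forall k, V (lift i0 k) (y k)) ->
  z + \sum_(k < n) y k = 0 -> z = 0 /\ forall k, y k = 0.
Proof.
move=> indV Vz Vy e.
pose a j := if unlift i0 j is Some k then y k else z.
have a0 : a i0 = z by rewrite /a unlift_none.
have aS k : a (lift i0 k) = y k by rewrite /a liftK.
have h : forall j, a j = 0.
  apply: indV => [j|].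
    by case: (unliftP i0 j) => [k ->|->]; rewrite ?aS ?a0.
  by rewrite (bigD1_ord i0) //= a0; under eq_bigr do rewrite aS.
by split=> [|k]; [rewrite -a0|rewrite -aS].
Qed.

(** Induction on [n], with [W] the sum of all [V] but the first. If every [N i] meets [W], all but
    one are intersected with [W]. Otherwise some [N i0] meets [W] trivially, and each other [N i] is
    replaced by the part of [N i + N i0] in [W], which is non-zero because the first [V] is
    uniform. *)
Theorem uniform_exchange n (V : 'I_n -> S -> Prop) m (N : 'I_m -> S -> Prop) :
  (forall j, submodule (V j)) -> (forall j, uniform_submodule (V j)) ->
  independent V ->
  (forall i, submodule (N i)) -> (forall i, nonzero (N i)) ->
  (forall i, psubset (N i) (sum_submodule V)) -> independent N ->
  (m <= n)%N.
Proof.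
elim: n V m N => [|n IH] V [|m] N // sV uV iV sN nzN NV iN.
  have [x [Nx nx]] := nzN ord0; have [v _] := NV _ _ Nx.
  by rewrite big_ord0.
pose V' j := V (lift ord0 j).
have sV' : forall j, submodule (V' j) by move=> j; apply: sV.
have uV' : forall j, uniform_submodule (V' j) by move=> j; apply: uV.
have sW := submodule_sum_submodule sV'; set W := sum_submodule V' in sW.
have iVW v w : V ord0 v -> W w -> v + w = 0 -> v = 0.
  by move=> Vv [y Vy ->] e; have [] := independent_lift iV Vv Vy e.
have iV' : independent V'.
  move=> a Va e; have V00 : V ord0 0 by case: (sV ord0).
  by have [|_] := independent_lift iV V00 Va; rewrite ?add0r.
have dec x i : N i x -> exists v w, [/\ V ord0 v, W w & x = v + w].
  move=> /NV[a Va ->]; exists (a ord0), (\sum_(k < n) a (lift ord0 k)).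
  rewrite big_ord_recl; split=> //; exists (fun k => a (lift ord0 k)) => // k.
  exact: Va.
(* It suffices to shrink N, at the cost of one member, into the sum of the
   last n submodules. *)
suff [N' [sN' nzN' N'W iN']] : exists N' : 'I_m -> S -> Prop,
    [/\ forall i, submodule (N' i), forall i, nonzero (N' i),
        forall i, psubset (N' i) W & independent N'].
  by rewrite ltnS; apply: (IH V' m N').
have [[i0 NW0]|/forallNP nNW] :=
    pselect (exists i0, forall x, N i0 x -> W x -> x = 0); last first.
  exists (fun i x => N (lift ord0 i) x /\ W x); split.
  - by move=> i; apply: submoduleI.
  - move=> i; have /existsNP[x /not_implyP[Nx /not_implyP[Wx nx]]] :=
      nNW (lift ord0 i).
    by exists x.
  - by move=> i x [].
  - move=> a Na e.
    have N00 : N ord0 0 by case: (sN ord0).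
    have [k||//] := independent_lift (y := a) iN N00; first by case: (Na k).
    by rewrite add0r.
exists (fun i x => W x /\ exists y z,
  [/\ N (lift i0 i) y, N i0 z & x = y + z]); split.
- move=> i; have [N0 [NB NM]] := sN i0; have [L0 [LB LM]] := sN (lift i0 i).
  apply: submoduleI => //; split; [|split].
  + by exists 0, 0; rewrite addr0.
  + move=> _ _ [y [z [Ly Nz ->]]] [y' [z' [Ly' Nz' ->]]].
    exists (y - y'), (z - z'); rewrite opprD addrACA.
    by split=> //; [apply: LB|apply: NB].
  + move=> b _ Bb [y [z [Ly Nz ->]]]; exists (b * y), (b * z).
    by rewrite mulrDr; split=> //; [apply: LM|apply: NM].
- move=> i; set M := N (lift i0 i).
  have sM : submodule M by apply: sN.
  have [[x [[Mx Wx] nx]]|nMW] := pselect (nonzero (fun x => M x /\ W x)).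
    exists x; split=> //; split=> //; exists x, 0.
    by rewrite addr0; split=> //; case: (sN i0).
  have NM0 x : M x -> N i0 x -> x = 0.
    move=> Mx Nx; apply: oppr_inj; rewrite oppr0.
    have [|k||//] := @independent_lift _ _ i0 (- x)
      (fun k => if k == i then x else 0) iN.
    + exact: submoduleN.
    + by case: eqP => [->//|_]; case: (sN (lift i0 k)).
    + by rewrite -big_mkcond big_pred1_eq addNr.
  (* Projection to the first summand along [W]. Here [M] and [N i0] both meet [W] trivially, so both
     projections are non-zero and share some [v <> 0]; the difference of the two lifts of [v] lies
     in [W]. *)
  pose proj L v := V ord0 v /\ exists2 w, W w & L (v + w).
  have sproj L : submodule L -> submodule (proj L).
    move=> [L0 [LB LM]]; have [V0 [VB VM]] := sV ord0.
    have [W0 [WB WM]] := sW; split; [|split].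
    + by split=> //; exists 0; rewrite ?addr0.
    + move=> x y [Vx [w Ww Lw]] [Vy [w' Ww' Lw']]; split; first exact: VB.
      by exists (w - w'); [apply: WB|rewrite addrACA -opprD; apply: LB].
    + move=> b x Bb [Vx [w Ww Lw]]; split; first exact: VM.
      by exists (b * w); [apply: WM|rewrite -mulrDr; apply: LM].
  have nzproj j : (forall x, N j x -> W x -> x = 0) -> nonzero (proj (N j)).
    move=> NjW; have [x [Nx nx]] := nzN j; have [v [w [Vv Ww xe]]] := dec _ _ Nx.
    exists v; split; first by split=> //; exists w; rewrite -?xe.
    by move=> v0; apply/nx/NjW => //; rewrite xe v0 add0r.
  have [||||||v [[[Vv [w Ww Mw]] [_ [w' Ww' Nw']]] nv]] :=
      uV ord0 (proj M) (proj (N i0)).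
  + exact: sproj.
  + exact/sproj/sN.
  + apply: nzproj => x Mx Wx; apply: contrapT => nx.
    by apply: nMW; exists x.
  + exact: nzproj.
  + by move=> x [].
  + by move=> x [].
  exists (w - w'); split.
    split; first by case: sW => _ [h _]; apply: h.
    exists (v + w), (- (v + w')); split=> //; first exact: submoduleN.
    by rewrite opprD addrACA subrr add0r.
  move=> /eqP; rewrite subr_eq0 => /eqP ww'; apply: nv.
  by apply: iVW Vv Ww _; apply: NM0 => //; rewrite ww'.
- by move=> i x [].
- move=> a /all_and2[Wa /choice[y /choice[z h]]] e.
  have Ny k : N (lift i0 k) (y k) by case: (h k).
  have Nz k : N i0 (z k) by case: (h k).
  have ae k : a k = y k + z k by case: (h k).
  (* Independence of [N] kills the [y] parts, which leaves [a k] in the trivial intersection of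
     [N i0] and [W]. *)
  have Nsz : N i0 (\sum_k z k) by apply: submodule_sum.
  have [|_ y0] := independent_lift iN Nsz Ny.
    by rewrite addrC -big_split /= -[RHS]e; apply: eq_bigr => k _; rewrite ae.
  by move=> k; apply: NW0 => //; rewrite ae y0 add0r.
Qed.

End Exchange.

(** * Left ideals and independent families of uniform elements *)

Section LeftIdeals.
Variable R : pzRingType.
Local Notation fullR := (fun _ : R => True).

Lemma principal_left_ideal a : left_ideal fullR (fun x => exists r, x = r * a).
Proof.
split=> //; split; [|split].
- by exists 0; rewrite mul0r.
- by move=> _ _ [r ->] [r' ->]; exists (r - r'); rewrite mulrBl.
- by move=> b _ _ [r ->]; exists (b * r); rewrite mulrA.
Qed.

Lemma principal_nonzero a : a <> 0 -> nonzero (fun x : R => exists r, x = r * a).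
Proof. by move=> na; exists a; split=> //; exists 1; rewrite mul1r. Qed.

Lemma essentialI (B E E' : R -> Prop) :
  essential_left_ideal B E -> essential_left_ideal B E' ->
  essential_left_ideal B (fun x => E x /\ E' x).
Proof.
move=> [[EB sE] essE] [[EB' sE'] essE']; split.
  by split; [move=> x [/EB]|apply: submoduleI].
move=> L lL nzL; have [LB sL] := lL.
have lLE : left_ideal B (fun x => L x /\ E x).
  by split; [move=> x [/LB]|apply: submoduleI].
have [x [[[Lx Ex] E'x] nx]] := essE' _ lLE (essE _ lL nzL).
by exists x.
Qed.

Lemma left_singularB (B : R -> Prop) x y : is_subring B ->
  left_singular B x -> left_singular B y -> left_singular B (x - y).
Proof.
move=> [_ [BB _]] [Bx [E [essE Ex]]] [By [E' [essE' Ey]]]; split; first exact: BB.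
exists (fun z => E z /\ E' z); split; first exact: essentialI.
by move=> e [Ee E'e]; rewrite mulrBr Ex // Ey // subrr.
Qed.

(* Independence of the family of the principal left ideals R k, k in K. *)
Definition left_independent (K : R -> Prop) : Prop :=
  forall n (f c : 'I_n -> R), injective f -> (forall i, K (f i)) ->
    \sum_(i < n) c i * f i = 0 -> forall i, c i * f i = 0.

Definition uniform_element (k : R) : Prop :=
  uniform_left_ideal fullR (fun x => exists r, x = r * k).

Inductive left_span (K : R -> Prop) : R -> Prop :=
| left_span0 : left_span K 0
| left_span_cons r k x : K k -> left_span K x -> left_span K (r * k + x).

Lemma left_spanM K b x : left_span K x -> left_span K (b * x).
Proof.
elim=> [|r k y Kk _ IH]; first by rewrite mulr0; apply: left_span0.
by rewrite mulrDr mulrA; apply: left_span_cons.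
Qed.

Lemma left_spanD K x y : left_span K x -> left_span K y -> left_span K (x + y).
Proof.
move=> Kx Ky; elim: Kx => [|r k z Kk _ IH]; first by rewrite add0r.
by rewrite -addrA; apply: left_span_cons.
Qed.

Lemma left_span_mul K r k : K k -> left_span K (r * k).
Proof.
by move=> Kk; rewrite -[_ * _]addr0; apply: left_span_cons => //; apply: left_span0.
Qed.

Lemma left_span_left_ideal K : left_ideal fullR (left_span K).
Proof.
split=> //; split; [exact: left_span0|split].
- move=> x y Kx Ky; apply: left_spanD => //.
  by rewrite -mulN1r; apply: left_spanM.
- by move=> b x _; apply: left_spanM.
Qed.

Lemma uniform_element_mem U u :
  uniform_left_ideal fullR U -> U u -> u <> 0 -> uniform_element u.
Proof.
move=> [[_ [_ [_ UM]]] [_ unU]] Uu nu; split; first exact: principal_left_ideal.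
split; first exact: principal_nonzero.
have uU : psubset (fun x => exists r, x = r * u) U by move=> _ [r ->]; apply: UM.
move=> L1 L2 lL1 lL2 nz1 nz2 L1u L2u.
by apply: unU => // x; [move=> /L1u|move=> /L2u]; apply: uU.
Qed.

(** Zorn's lemma on independent sets of uniform elements: a non-zero left ideal missing the span of
    a maximal [K] would contain a uniform [u] that could be added to [K]. *)
Theorem essential_uniform_elements : enough_uniform fullR ->
  exists K : R -> Prop, [/\ forall k, K k -> uniform_element k,
    left_independent K & essential_left_ideal fullR (left_span K)].
Proof.
move=> enR.
have [C CP totC|K [[unK indK] maxK]] := @Zorn_bigcup _ (fun K : set R =>
    (forall k, K k -> uniform_element k) /\ left_independent K).
  split=> [k [D CD Dk]|n f c fI fC e i]; first by have [h _] := CP _ CD; apply: h.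
  have [x /mapP[j _ ->]|f0|[D CD fD]] := @chain_seq _ C [seq f j | j <- enum 'I_n] totC.
  - exact: fC.
  - have: f i \in [seq f j | j <- enum 'I_n] by rewrite map_f ?mem_enum.
    by rewrite f0.
  - have [_ h] := CP _ CD; apply: h => // j.
    by apply: fD; rewrite map_f ?mem_enum.
exists K; split=> //; split; first exact: left_span_left_ideal.
move=> L lL nzL; have [U [unU UL]] := enR L lL nzL.
have [[_ [_ [_ UM]]] [[u [Uu nu]] _]] := unU.
apply: contrapT => disj.
have {}disj r : left_span K (r * u) -> r * u = 0.
  by move=> Kru; apply: contrapT => nz; apply: disj; exists (r * u); split=> //;
    split=> //; apply/UL/UM.
have nKu : ~ K u.
  by move=> Ku; apply: nu; rewrite -[u]mul1r; apply/disj/left_span_mul.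
case: (maxK (fun k => K k \/ k = u)).
  split; first by move=> k; left.
  by move=> /(_ u (or_intror erefl)).
split=> [k [/unK//|->]|]; first exact: uniform_element_mem Uu nu.
move=> n f c fI fK e i.
have [[i0 fi0]|nu'] := pselect (exists i0, f i0 = u); last first.
  by apply: indK => // j; case: (fK j) => // fj; case: nu'; exists j.
case: n => [|n] in f c fI fK e i i0 fi0 *; first by case: i.
have fK' j : K (f (lift i0 j)).
  case: (fK (lift i0 j)) => //; rewrite -fi0 => /fI/eqP.
  by rewrite eq_sym (negPf (neq_lift i0 j)).
move: e; rewrite (bigD1_ord i0) //= => e.
have z0 : c i0 * f i0 = 0.
  rewrite fi0; apply: disj; rewrite -fi0.
  move/eqP: e; rewrite addr_eq0 => /eqP->; rewrite -mulN1r; apply: left_spanM.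
  apply: (big_ind (left_span K)); first exact: left_span0.
    by move=> *; apply: left_spanD.
  by move=> j _; apply: left_span_mul.
case: (unliftP i0 i) => [j ->|->//].
apply: (indK _ (fun j => f (lift i0 j)) (fun j => c (lift i0 j))) => //.
  by move=> x y /fI/lift_inj.
by rewrite z0 add0r in e.
Qed.

End LeftIdeals.

Lemma udim_le_card (S1 S2 : pzRingType) (B1 : S1 -> Prop) (B2 : S2 -> Prop) :
  (forall I, has_indep B1 I -> exists J, has_indep B2 J /\ card_le I J) ->
  udim_le B1 B2.
Proof.
move=> h I /h[J [hJ [u uI]]] L [[v vI] nIL]; exists J; split=> //; split.
  by exists (u \o v); apply: inj_comp.
by move=> [w wI]; apply: nIL; exists (w \o u); apply: inj_comp.
Qed.

(** * Right coefficients in the skew group ring *)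

Section SkewRing.
Variables (R : pzRingType) (G : zmodType) (alpha : G -> {rmorphism R -> R}).
Variables (S : pzRingType) (iota : {rmorphism R -> S}) (phi : G -> S).
Hypothesis alphaP : aut_action alpha.
Hypothesis SP : is_skew_group_ring alpha iota phi.

Lemma act0 a : alpha 0 a = a.
Proof. by case: alphaP => _ []. Qed.

Lemma actD g h a : alpha (g + h) a = alpha g (alpha h a).
Proof. by case: alphaP => _ []. Qed.

Lemma actK g : cancel (alpha g) (alpha (- g)).
Proof. by move=> a; rewrite -actD addNr act0. Qed.

Lemma actNK g : cancel (alpha (- g)) (alpha g).
Proof. by move=> a; rewrite -actD subrr act0. Qed.

Lemma act_eq0 g a : alpha g a = 0 -> a = 0.
Proof. by move=> e; rewrite -(actK g a) e rmorph0. Qed.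

Lemma term0 : phi 0 = 1. Proof. by case: SP. Qed.

Lemma termD g h : phi (g + h) = phi g * phi h.
Proof. by case: SP => _ []. Qed.

Lemma term_mul g a : phi g * iota a = iota (alpha g a) * phi g.
Proof. by case: SP => _ [_ []]. Qed.

Lemma mul_term g a : iota a * phi g = phi g * iota (alpha (- g) a).
Proof. by rewrite term_mul actNK. Qed.

Lemma termVl g : phi (- g) * phi g = 1.
Proof. by rewrite -termD addNr term0. Qed.

Lemma termVr g : phi g * phi (- g) = 1.
Proof. by rewrite -termD subrr term0. Qed.

Lemma term_reg g s : phi g * s = 0 -> s = 0.
Proof. by move=> e; rewrite -[s]mul1r -(termVl g) -mulrA e mulr0. Qed.

Lemma reg_term g s : s * phi g = 0 -> s = 0.
Proof. by move=> e; rewrite -[s]mulr1 -(termVr g) mulrA e mul0r. Qed.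

(* Coefficients are taken on the right of the terms, because a left ideal U of
   R then extends to the left ideal of the elements with coefficients in U. *)
Definition expansion (s : S) (c : G -> R) (l : seq G) : Prop :=
  [/\ uniq l, forall g, g \notin l -> c g = 0
    & s = \sum_(g <- l) phi g * iota (c g)].

Lemma expansion_widen s c l l' : expansion s c l ->
  uniq l' -> {subset l <= l'} -> expansion s c l'.
Proof.
move=> [ul cl ->] ul' sub; split=> // [g gl'|].
  by apply: cl; apply: contra gl' => /sub.
rewrite [RHS](bigID (mem l)) /= [X in _ = _ + X]big1 ?addr0; last first.
  by move=> g /cl->; rewrite rmorph0 mulr0.
rewrite -[RHS]big_filter; apply: perm_big; apply: uniq_perm => //.
  exact: filter_uniq.
by move=> g; rewrite mem_filter /=; case gl: (g \in l) => //=; rewrite sub.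
Qed.

Lemma expansionB s t c d l l' : expansion s c l -> expansion t d l' ->
  expansion (s - t) (fun g => c g - d g) (undup (l ++ l')).
Proof.
move=> cl dl'.
have [g gl|_ c0 se] := expansion_widen (l' := undup (l ++ l')) cl (undup_uniq _).
  by rewrite mem_undup mem_cat gl.
have [g gl|_ d0 te] := expansion_widen (l' := undup (l ++ l')) dl' (undup_uniq _).
  by rewrite mem_undup mem_cat gl orbT.
split=> [|g gn|]; first exact: undup_uniq.
  by rewrite c0 // d0 // subr0.
by rewrite {1}se {1}te -sumrB; apply: eq_bigr => g _; rewrite rmorphB mulrBr.
Qed.

Lemma expansion_term g a :
  expansion (phi g * iota a) (fun h => if h == g then a else 0) [:: g].
Proof.
split=> // [h|]; last by rewrite big_seq1 eqxx.
by rewrite inE => /negPf->.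
Qed.

Lemma expansion0 : expansion 0 (fun=> 0) [::].
Proof. by split=> //; rewrite big_nil. Qed.

Lemma expansion_exists s : exists c l, expansion s c l.
Proof.
have [_ [_ [_ [spS _]]]] := SP; have [n [a [g ->]]] := spS s.
apply: (big_ind (fun s => exists c l, expansion s c l)).
- by exists (fun=> 0), [::]; apply: expansion0.
- move=> x y [c [l hx]] [d [l' hy]].
  have hNy := expansionB expansion0 hy; have := expansionB hx hNy.
  by rewrite sub0r opprK; eexists; eexists; eassumption.
- by move=> i _; rewrite mul_term; eexists; eexists; apply: expansion_term.
Qed.

Lemma expansion_zero c l : expansion 0 c l -> forall g, c g = 0.
Proof.
move=> [ul c0 e] g; have [gl|/c0//] := boolP (g \in l).
have [_ [_ [_ [_ indS]]]] := SP.
pose b (i : 'I_(size l)) := nth 0 l i.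
have bI : injective b by move=> i j /eqP; rewrite nth_uniq // => /eqP/val_inj.
have ig : (index g l < size l)%N by rewrite index_mem.
have gE : g = b (Ordinal ig) by rewrite /b /= nth_index.
apply: (@act_eq0 g); rewrite {2}gE {1}gE.
apply: (indS _ (fun i => alpha (b i) (c (b i))) b bI).
rewrite [RHS]e (big_nth 0) big_mkord; apply: eq_bigr => i _.
by rewrite -term_mul.
Qed.

(** The right coefficients, picked classically from some expansion; by [rc_unique] every expansion
    computes them. *)
Definition rc (s : S) : G -> R := sval (cid (expansion_exists s)).

Lemma rc_unique s c l : expansion s c l -> rc s =1 c.
Proof.
rewrite /rc; case: cid => d [l' /= hd] hc g; apply/eqP; rewrite -subr_eq0.
by apply/eqP; have := expansionB hd hc; rewrite subrr => /expansion_zero.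
Qed.

Lemma supp_exists s : exists l : seq G, [/\ uniq l,
  forall g, (g \in l) = (rc s g != 0) & s = \sum_(g <- l) phi g * iota (rc s g)].
Proof.
have [l [ul c0 se]] : exists l, expansion s (rc s) l by rewrite /rc; case: cid.
exists [seq g <- l | rc s g != 0]; split=> [|g|].
- exact: filter_uniq.
- rewrite mem_filter; case: eqVneq => //= nz.
  by apply: contra_neqT nz => /c0.
- rewrite big_filter [RHS]big_mkcond {1}se; apply: eq_bigr => g _.
  by case: eqP => //= ->; rewrite rmorph0 mulr0.
Qed.

Definition supp s : seq G := sval (cid (supp_exists s)).

Lemma supp_uniq s : uniq (supp s).
Proof. by rewrite /supp; case: cid => l []. Qed.

Lemma mem_supp s g : (g \in supp s) = (rc s g != 0).
Proof. by rewrite /supp; case: cid => l []. Qed.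

Lemma rcE s : s = \sum_(g <- supp s) phi g * iota (rc s g).
Proof. by rewrite /supp; case: cid => l []. Qed.

Lemma rc_expansion s : expansion s (rc s) (supp s).
Proof.
split; [exact: supp_uniq| |exact: rcE].
by move=> g; rewrite mem_supp negbK => /eqP.
Qed.

Lemma rc_eq0 s : (forall g, rc s g = 0) -> s = 0.
Proof. by move=> h; rewrite (rcE s) big1 // => g _; rewrite h rmorph0 mulr0. Qed.

Lemma rc_neq0 s : s <> 0 -> exists g, rc s g <> 0.
Proof. by move=> nz; apply/existsNP => /rc_eq0. Qed.

Lemma rcB s t g : rc (s - t) g = rc s g - rc t g.
Proof. exact: rc_unique (expansionB (rc_expansion s) (rc_expansion t)) g. Qed.

Lemma rc0 g : rc 0 g = 0.
Proof. exact: rc_unique expansion0 g. Qed.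

Lemma rcD s t g : rc (s + t) g = rc s g + rc t g.
Proof. by rewrite -[in LHS](opprK t) -[- t]sub0r !rcB rc0 sub0r opprK. Qed.

Lemma rc_sum (I : Type) (r : seq I) (F : I -> S) g :
  rc (\sum_(i <- r) F i) g = \sum_(i <- r) rc (F i) g.
Proof. exact: (big_morph (rc^~ g) (fun s t => rcD s t g) (rc0 g)). Qed.

Lemma rc_term g a h : rc (phi g * iota a) h = if h == g then a else 0.
Proof. exact: rc_unique (expansion_term g a) h. Qed.

Lemma rc_iota a g : rc (iota a) g = if g == 0 then a else 0.
Proof. by rewrite -[iota a]mul1r -term0 rc_term. Qed.

Lemma term_iota_eq0 g a : phi g * iota a = 0 -> a = 0.
Proof. by move=> e; have := rc_term g a g; rewrite e rc0 eqxx. Qed.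

Lemma iota_eq0 a : iota a = 0 -> a = 0.
Proof. by move=> e; apply: (@term_iota_eq0 0); rewrite e mulr0. Qed.

Lemma rc_terml h s g : rc (phi h * s) g = rc s (g - h).
Proof.
apply: (@rc_unique _ (fun g => rc s (g - h)) [seq k + h | k <- supp s]).
split.
- by rewrite map_inj_uniq ?supp_uniq //; apply: addIr.
- move=> k; apply: contraNeq; rewrite -mem_supp => ks.
  by apply/mapP; exists (k - h); rewrite ?subrK.
- rewrite {1}(rcE s) mulr_sumr big_map; apply: eq_bigr => k _.
  by rewrite addrK mulrA -termD addrC.
Qed.

Lemma rc_iotal r s g : rc (iota r * s) g = alpha (- g) r * rc s g.
Proof.
apply: (@rc_unique _ (fun g => alpha (- g) r * rc s g) (supp s)); split.
- exact: supp_uniq.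
- by move=> k; rewrite mem_supp negbK => /eqP->; rewrite mulr0.
- rewrite {1}(rcE s) mulr_sumr; apply: eq_bigr => k _.
  by rewrite mulrA mul_term rmorphM mulrA.
Qed.

Lemma rc_iotar s r g : rc (s * iota r) g = rc s g * r.
Proof.
apply: (@rc_unique _ (fun g => rc s g * r) (supp s)); split.
- exact: supp_uniq.
- by move=> k; rewrite mem_supp negbK => /eqP->; rewrite mul0r.
- by rewrite {1}(rcE s) mulr_suml; apply: eq_bigr => k _; rewrite rmorphM mulrA.
Qed.

(** Moving a coefficient [a] to the right of a term [phi k] turns it into [alpha (- k) a]; here
    [k = g - h]. *)
Lemma rc_mul p f g :
  rc (p * f) g = \sum_(h <- supp p) alpha (h - g) (rc p h) * rc f (g - h).
Proof.
rewrite {1}(rcE p) mulr_suml rc_sum; apply: eq_bigr => h _.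
by rewrite -mulrA rc_terml rc_iotal opprB.
Qed.

Lemma rc_mul_neq0 p f g : rc (p * f) g <> 0 ->
  exists h, rc p h <> 0 /\ rc f (g - h) <> 0.
Proof.
move=> nz; apply: contrapT => /forallNP h; apply: nz.
rewrite rc_mul big_seq big1 // => k; rewrite mem_supp => /eqP nk.
have [->|nz] := eqVneq (rc f (g - k)) 0; first by rewrite mulr0.
by case: (h k); split=> //; apply/eqP.
Qed.

Lemma rc_remove s h g :
  rc (s - phi h * iota (rc s h)) g = if g == h then 0 else rc s g.
Proof. by rewrite rcB rc_term; case: eqP => [->|_]; rewrite ?subrr ?subr0. Qed.

Lemma size_supp_remove s h : rc s h <> 0 ->
  (size (supp (s - phi h * iota (rc s h))) < size (supp s))%N.
Proof.
move=> nz; have: uniq (h :: supp (s - phi h * iota (rc s h))).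
  by rewrite /= supp_uniq mem_supp rc_remove eqxx eqxx.
move=> /uniq_leq_size; apply=> g; rewrite inE => /orP[/eqP->|].
  by rewrite mem_supp; apply/eqP.
by rewrite !mem_supp rc_remove; case: (g == h); rewrite ?eqxx.
Qed.

(** [term_span] writes coefficients on the left of the terms, and the left coefficient at [g] is
    [alpha g (rc s g)]. *)
Lemma term_span_rc (Z : R -> Prop) (T : G -> Prop) s :
  (forall g, rc s g <> 0 -> Z (alpha g (rc s g)) /\ T g) ->
  term_span iota phi Z T s.
Proof.
move=> h; exists (size (supp s)).
exists (fun i : 'I_(size (supp s)) => alpha (nth 0 (supp s) i) (rc s (nth 0 (supp s) i))).
exists (fun i : 'I_(size (supp s)) => nth 0 (supp s) i); split.
  by move=> i; apply/h/eqP; rewrite -mem_supp mem_nth.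
rewrite {1}(rcE s) (big_nth 0) big_mkord; apply: eq_bigr => i _.
by rewrite term_mul.
Qed.

Lemma in_term_span (T : G -> Prop) s :
  term_span iota phi (fun=> True) T s <-> forall g, rc s g <> 0 -> T g.
Proof.
split=> [[n [a [t [Tt ->]]]] g|h]; last by apply: term_span_rc => g /h.
apply: contra_notP => nTg; rewrite rc_sum big1 // => i _.
rewrite mul_term rc_term; case: eqP => // gt.
by case: nTg; rewrite gt; case: (Tt i).
Qed.

(** * Leading terms and reduction to one coefficient *)

Section Ordered.
Variable P : G -> Prop.
Hypothesis P_cone : positive_cone P.
Hypothesis P_total : forall g, g <> 0 -> P g \/ P (- g).

(** [P (t - g)] reads: [g] is smaller than [t]. *)
Definition leading (s : S) (t : G) : Prop :=
  rc s t <> 0 /\ forall g, rc s g <> 0 -> g <> t -> P (t - g).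

Lemma leading_exists s : s <> 0 -> exists t, leading s t.
Proof.
move=> /rc_neq0[g0 nz].
have: g0 \in supp s by rewrite mem_supp; apply/eqP.
suff max (l : seq G) : l <> [::] ->
    exists2 t, t \in l & forall g, g \in l -> g <> t -> P (t - g).
  move=> g0s; have [|t ts tmax] := max (supp s); first by case: (supp s) g0s.
  exists t; split; first by apply/eqP; rewrite -mem_supp.
  by move=> g /eqP; rewrite -mem_supp; apply: tmax.
elim: l => // x l IH _; have [->|/IH[t tl tmax]] := pselect (l = [::]).
  exists x; first exact: mem_head.
  by move=> g; rewrite inE => /eqP.
have [xt|xt] := pselect (x = t).
  exists t; first by rewrite inE tl orbT.
  by move=> g; rewrite inE => /orP[/eqP->//|]; apply: tmax.
have [|Pxt|] := P_total (g := x - t).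
- by move/eqP; rewrite subr_eq0 => /eqP.
- exists x; first exact: mem_head.
  move=> g; rewrite inE => /orP[/eqP//|gl _].
  have [->//|/eqP gt] := eqVneq g t.
  by rewrite -(subrKA t); case: P_cone => _ PD; apply: PD => //; apply: tmax.
- rewrite opprB => Ptx; exists t; first by rewrite inE tl orbT.
  by move=> g; rewrite inE => /orP[/eqP->//|]; apply: tmax.
Qed.

(** Only the pair [(h, t)] reaches degree [h + t]: any other [k] in the support of [p] is below [h]
    and would need a partner above [t]. The value may still be 0. *)
Lemma leading_mul p f h t : leading p h -> leading f t ->
  rc (p * f) (h + t) = alpha (- t) (rc p h) * rc f t.
Proof.
move=> [nph hmax] [nft tmax].
rewrite rc_mul (bigD1_seq h) ?supp_uniq //=; last by rewrite mem_supp; apply/eqP.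
rewrite opprD addNKr addrAC subrr add0r big_seq_cond big1 ?addr0 //.
move=> k /andP[]; rewrite mem_supp => /eqP nk /eqP kh.
have [->|/eqP nz] := eqVneq (rc f (h + t - k)) 0; first by rewrite mulr0.
have Phk := hmax k nk kh; have [nP0 PD] := P_cone.
have [e|ne] := pselect (h + t - k = t).
  by case: kh; apply/esym/subr0_eq/(addIr t); rewrite add0r addrAC.
have := PD _ _ Phk (tmax _ nz ne).
by rewrite [h + t - k]addrAC addrA subrr.
Qed.

(* Among the non-zero multiples r f choose one of minimal support: any r killing
   its leading coefficient a then kills all of r f. *)
Lemma cyclic_reduction f : f <> 0 -> exists r a,
  iota r * f <> 0 /\ forall p, p * (iota r * f) = 0 <-> p * iota a = 0.
Proof.
move=> nf.
have ex : exists n, `[< exists2 r, iota r * f <> 0 & size (supp (iota r * f)) = n >].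
  by exists (size (supp f)); apply/asboolP; exists 1; rewrite rmorph1 mul1r.
case: (ex_minnP ex) => n /asboolP[r nrf sn] minn.
have [t tf] := leading_exists nrf; have [nt _] := tf.
set f' := iota r * f in nrf sn nt tf *.
(* The leading coefficient on the left of its term: [x * a = 0] exactly when [iota x] kills the
   coefficient at [t]. *)
pose a := alpha t (rc f' t).
have killf x : x * a = 0 -> iota x * f' = 0.
  move=> xa; have e : rc (iota x * f') t = 0.
    by rewrite rc_iotal -(actK t (rc f' t)) -rmorphM xa rmorph0.
  apply: contrapT => nxf.
  have: (n <= size (supp (iota x * f')))%N.
    by apply: minn; apply/asboolP; exists (x * r); rewrite rmorphM -mulrA.
  rewrite leqNgt => /negP; apply; rewrite -sn.
  have: uniq (t :: supp (iota x * f')) by rewrite /= supp_uniq mem_supp e eqxx.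
  move=> /uniq_leq_size; apply=> g; rewrite inE => /orP[/eqP->|].
    by rewrite mem_supp; apply/eqP.
  rewrite !mem_supp rc_iotal; apply: contra_neq => ->.
  by rewrite mulr0.
exists r, a; split=> // p; split; last first.
  move=> pa; rewrite (rcE p) mulr_suml big1 // => g _.
  by rewrite -mulrA killf ?mulr0 // -rc_iotar pa rc0.
have [m] := ubnP (size (supp p)); elim: m p => // m IH p pm pf.
have [->|/eqP np] := eqVneq p 0; first by rewrite mul0r.
have [h hp] := leading_exists np; have [nh _] := hp.
have ca : rc p h * a = 0.
  apply: (@act_eq0 (- t)); rewrite rmorphM actK.
  by rewrite -(leading_mul hp tf) pf rc0.
have p1 := killf _ ca.
rewrite -(subrK (phi h * iota (rc p h)) p) mulrDl IH ?add0r.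
- by rewrite -mulrA -rmorphM ca rmorph0 mulr0.
- by rewrite -ltnS; apply: leq_trans pm; rewrite ltnS; apply: size_supp_remove.
- by rewrite mulrBl pf -mulrA p1 mulr0 subr0.
Qed.

(** * Extension of left ideals from [R] to [A] *)

Section Extension.
Variable T : G -> Prop.
Hypothesis T_monoid : is_submonoid T.

Local Notation A := (term_span iota phi (fun=> True) T).
Local Notation fullR := (fun _ : R => True).

Lemma term_span_subring : is_subring A.
Proof.
have [T0 TD] := T_monoid; split; [|split].
- apply/in_term_span => g; rewrite -(rmorph1 iota) rc_iota.
  by case: eqP => // ->.
- move=> x y /in_term_span Ax /in_term_span Ay; apply/in_term_span => g.
  rewrite rcB; have [->|/eqP/Ax//] := eqVneq (rc x g) 0.
  have [->|/eqP/Ay//] := eqVneq (rc y g) 0; by rewrite subr0.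
- move=> x y /in_term_span Ax /in_term_span Ay; apply/in_term_span => g.
  by move=> /rc_mul_neq0[h [/Ax Th /Ay Tgh]]; rewrite -(subrK h g); apply: TD.
Qed.

Lemma term_span_iota a : A (iota a).
Proof.
apply/in_term_span => g; rewrite rc_iota; case: eqP => // -> _.
by case: T_monoid.
Qed.

Lemma term_span_term t : T t -> A (phi t).
Proof.
move=> Tt; apply/in_term_span => g.
by rewrite -[phi t]mulr1 -(rmorph1 iota) rc_term; case: eqP => // ->.
Qed.

Lemma term_span_mul x y : A x -> A y -> A (x * y).
Proof. by case: term_span_subring => _ [_]; apply. Qed.

Lemma term_span_sub x y : A x -> A y -> A (x - y).
Proof. by case: term_span_subring => _ [h _]; apply: h. Qed.

Lemma term_span0 : A 0.
Proof. by rewrite -(rmorph0 iota); apply: term_span_iota. Qed.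

(** The extension [A U], described by coefficients. *)
Definition ext_ideal (U : R -> Prop) (s : S) : Prop := A s /\ forall g, U (rc s g).

Lemma ext_ideal_left_ideal U : left_ideal fullR U -> left_ideal A (ext_ideal U).
Proof.
move=> [_ sU]; have [U0 [UB UM]] := sU; split; [|split; [|split]].
- by move=> s [].
- by split=> [|g]; [exact: term_span0|rewrite rc0].
- move=> x y [Ax Ux] [Ay Uy]; split; first exact: term_span_sub.
  by move=> g; rewrite rcB; apply: UB.
- move=> b x Ab [Ax Ux]; split; first exact: term_span_mul.
  by move=> g; rewrite rc_mul; apply: (submodule_sum sU) => h _; apply: UM.
Qed.

Lemma ext_ideal_iota U u : U 0 -> U u -> ext_ideal U (iota u).
Proof.
move=> U0 Uu; split; first exact: term_span_iota.
by move=> g; rewrite rc_iota; case: eqP.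
Qed.

Lemma ext_ideal_nonzero U : U 0 -> nonzero U -> nonzero (ext_ideal U).
Proof.
move=> U0 [u [Uu nu]]; exists (iota u); split; first exact: ext_ideal_iota.
by move=> /iota_eq0.
Qed.

(* The coefficients are moved into E one at a time. *)
Lemma essential_multiple E f : essential_left_ideal fullR E -> f <> 0 ->
  exists2 r, iota r * f <> 0 & forall g, E (rc (iota r * f) g).
Proof.
move=> [[_ [E0 [EB EM]]] essE] nf.
suff [r nrf Er] : exists2 r, iota r * f <> 0 &
    forall g, g \in supp f -> E (rc (iota r * f) g).
  exists r => // g; have [/Er//|] := boolP (g \in supp f).
  by rewrite mem_supp negbK rc_iotal => /eqP->; rewrite mulr0.
elim: (supp f) => [|g l [r nrf Er]]; first by exists 1; rewrite rmorph1 ?mul1r.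
have [z|/eqP nz] := eqVneq (rc (iota r * f) g) 0.
  by exists r => // h; rewrite inE => /orP[/eqP->|/Er//]; rewrite z.
have [y [[[x ->] Ex] nx]] :=
  essE _ (principal_left_ideal _) (principal_nonzero nz).
(* The factor [alpha g] cancels the twist at degree [g], so the coefficient there becomes exactly
   the element of [E] just found. *)
exists (alpha g x * r) => [|h]; rewrite rmorphM -mulrA.
  by move=> e; apply: nx; rewrite -[x](actK g) -rc_iotal e rc0.
rewrite inE rc_iotal => /orP[/eqP->|/Er]; first by rewrite actK.
exact: EM.
Qed.

Lemma ext_ideal_essential E :
  essential_left_ideal fullR E -> essential_left_ideal A (ext_ideal E).
Proof.
move=> essE; split; first by apply: ext_ideal_left_ideal; case: essE.
move=> L [LA [_ [_ LM]]] [f [Lf nf]].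
have [r nrf Er] := essential_multiple essE nf.
have Lrf : L (iota r * f) by apply: LM => //; apply: term_span_iota.
by exists (iota r * f); do 3!split=> //; apply: LA.
Qed.

(** Right coefficients multiply [a] directly, so the extension of the annihilating essential ideal
    [E] annihilates [iota a * phi t]. *)
Lemma left_singular_term a t : left_singular fullR a -> T t ->
  left_singular A (iota a * phi t).
Proof.
move=> [_ [E [essE Ea]]] Tt; split.
  by apply: term_span_mul; [exact: term_span_iota|exact: term_span_term].
exists (ext_ideal E); split; first exact: ext_ideal_essential.
move=> e [_ Ee]; rewrite (rcE e) mulr_suml big1 // => g _.
by rewrite mulrA -[_ * iota a]mulrA -rmorphM Ea // rmorph0 mulr0 mul0r.
Qed.

(** A non-zero left ideal [L] of [R] extends to one that meets the essential ideal annihilating [s];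
    the leading coefficient of a common element is a non-zero member of [L] annihilating
    [alpha t (rc s t)]. *)
Lemma left_singular_leading s t : left_singular A s -> leading s t ->
  left_singular fullR (alpha t (rc s t)).
Proof.
move=> [As [E [essE Es]]] st; split=> //.
exists (fun r => r * alpha t (rc s t) = 0); split=> //; split.
  split=> //; split; [|split].
  - by rewrite mul0r.
  - by move=> x y hx hy; rewrite mulrBl hx hy subrr.
  - by move=> b x _ hx; rewrite -mulrA hx mulr0.
move=> L lL nzL; have [_ [L0 _]] := lL.
have [f [[[Af Lf] Ef] nf]] := essE.2 _ (ext_ideal_left_ideal lL)
  (ext_ideal_nonzero L0 nzL).
have [h hf] := leading_exists nf; exists (rc f h); split; last by case: hf.
split=> //; apply: (@act_eq0 (- t)).
by rewrite rmorphM actK -(leading_mul hf st) Es // rc0.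
Qed.

(** A singular leading coefficient makes the leading term itself singular; subtracting it leaves a
    singular element of smaller support, so every coefficient is reached in turn. *)
Theorem left_singular_term_span s :
  left_singular A s <-> term_span iota phi (left_singular fullR) T s.
Proof.
have left_singular0 : left_singular A 0.
  split; first exact: term_span0.
  exists A; split; last by move=> e _; rewrite mulr0.
  split; first split=> //; first split; [exact: term_span0|split| ].
  - exact: term_span_sub.
  - exact: term_span_mul.
  - by move=> L [LA _] [x [Lx nx]]; exists x; do 2!split=> //; apply: LA.
split=> [Zs|[n [a [t [aT ->]]]]]; last first.
  apply: (big_ind (left_singular A)) => // [x y Zx Zy|i _].
    rewrite -[y]opprK; apply: left_singularB => //; first exact: term_span_subring.
    by rewrite -sub0r; apply: left_singularB => //; exact: term_span_subring.
  by have [? ?] := aT i; apply: left_singular_term.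
have As := Zs.1; apply: term_span_rc => g nz; split; last first.
  by move: As nz => /in_term_span; apply.
have [m] := ubnP (size (supp s)); elim: m s Zs As nz => // m IH s Zs As nz sm.
have ns : s <> 0 by move=> s0; apply: nz; rewrite s0 rc0.
have [t st] := leading_exists ns; have Za := left_singular_leading Zs st.
have [->//|/eqP gt] := eqVneq g t.
have nt := st.1; have Tt : T t by move: As nt => /in_term_span; apply.
have rE : rc (s - phi t * iota (rc s t)) g = rc s g by rewrite rc_remove; case: eqP.
have Zs' : left_singular A (s - phi t * iota (rc s t)).
  apply: left_singularB => //; first exact: term_span_subring.
  by rewrite term_mul; apply: left_singular_term.
rewrite -rE; apply: IH => //; first exact: Zs'.1; first by rewrite rE.
by rewrite -ltnS; apply: leq_trans sm; rewrite ltnS; apply: size_supp_remove.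
Qed.

Lemma independent_terms (U : R -> Prop) (F : seq G) : uniq F ->
  independent (fun (j : 'I_(size F)) s => exists2 u, U u & s = phi F`_j * iota u).
Proof.
move=> uF a Va e k.
have /choice[u ae] : forall j, exists u, a j = phi F`_j * iota u.
  by move=> j; have [u _ ->] := Va j; exists u.
rewrite ae; move: (rc0 F`_k).
rewrite -{1}e rc_sum (bigD1 k) //= big1 => [|j jk].
  by rewrite addr0 ae rc_term eqxx => ->; rewrite rmorph0 mulr0.
by rewrite ae rc_term nth_uniq // eq_sym val_eqE (negPf jk).
Qed.

(** The map [u |-> phi t * iota u] is injective and semilinear along [alpha t], so [R]-submodules of
    its image on [U] pull back to left ideals inside [U]. *)
Lemma uniform_term U t : uniform_left_ideal fullR U ->
  uniform_submodule (fun s => exists r, s = iota r)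
    (fun s => exists2 u, U u & s = phi t * iota u).
Proof.
move=> [lU [_ uU]] L1 L2 sL1 sL2 nz1 nz2 L1U L2U.
pose pull (L : S -> Prop) u := L (phi t * iota u).
have lpull L : submodule (fun s => exists r, s = iota r) L ->
    left_ideal fullR (pull L).
  move=> [L0 [LB LM]]; split=> //; rewrite /pull; split; [|split].
  - by rewrite rmorph0 mulr0.
  - by move=> x y; rewrite rmorphB mulrBr; apply: LB.
  - move=> b x _ Lx; rewrite rmorphM mulrA term_mul -mulrA.
    by apply: LM => //; eexists.
have subpull L : psubset L (fun s => exists2 u, U u & s = phi t * iota u) ->
    psubset (pull L) U.
  move=> LU u /LU[u' Uu' /eqP]; rewrite -subr_eq0 -mulrBr -rmorphB.
  by move=> /eqP/term_iota_eq0/subr0_eq->.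
have nzpull L : psubset L (fun s => exists2 u, U u & s = phi t * iota u) ->
    nonzero L -> nonzero (pull L).
  move=> LU [x [Lx nx]]; have [u Uu xe] := LU _ Lx; exists u.
  by split; [rewrite /pull -xe|move=> u0; apply: nx; rewrite xe u0 rmorph0 mulr0].
have [u [[L1u L2u] nu]] := uU _ _ (lpull _ sL1) (lpull _ sL2)
  (nzpull _ L1U nz1) (nzpull _ L2U nz2) (subpull _ L1U) (subpull _ L2U).
by exists (phi t * iota u); split=> // /term_iota_eq0.
Qed.

(* If A f and A g met trivially, the sums F_n of n elements of the supports of f
   and g would give 2 |F_n| independent R-submodules inside the direct sum of
   |F_{n+1}| uniform ones, although |F_n| grows only polynomially. *)
Theorem ext_ideal_uniform U :
  uniform_left_ideal fullR U -> uniform_left_ideal A (ext_ideal U).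
Proof.
move=> unU; have [lU [nzU _]] := unU; have [_ sU] := lU; have U0 := sU.1.
split; first exact: ext_ideal_left_ideal.
split; first exact: ext_ideal_nonzero.
move=> L1 L2 lL1 lL2 [f0 [L1f0 nf0]] [g0 [L2g0 ng0]] L1U L2U.
apply: contrapT => disj.
have {}disj x : L1 x -> L2 x -> x = 0.
  by move=> ? ?; apply: contrapT => ?; apply: disj; exists x.
(* The reduction makes the translates of one element independent: a relation among the [phi t * f]
   becomes one among the [phi t * iota a], where the terms are distinct. *)
have [rf [a [nf fa]]] := cyclic_reduction nf0.
have [rg [b [ng gb]]] := cyclic_reduction ng0.
set f := iota rf * f0 in nf fa; set g := iota rg * g0 in ng gb.
have L1M p x : A p -> L1 x -> L1 (p * x) by case: lL1 => _ [_ [_]]; apply.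
have L2M p x : A p -> L2 x -> L2 (p * x) by case: lL2 => _ [_ [_]]; apply.
have L1f : L1 f by apply: L1M => //; apply: term_span_iota.
have L2g : L2 g by apply: L2M => //; apply: term_span_iota.
have [Af Uf] := L1U _ L1f; have [Ag Ug] := L2U _ L2g.
pose K := supp f ++ supp g.
have KT k : k \in K -> T k.
  rewrite mem_cat !mem_supp => /orP[] /eqP.
    by move: Af => /in_term_span; apply.
  by move: Ag => /in_term_span; apply.
have [n] := sumset_small_doubling K; rewrite mul2n -addnn ltnNge => /negP; apply.
set F := sumset K n; set F' := sumset K n.+1.
have FT i : (i < size F)%N -> T F`_i.
  by move=> /(mem_nth 0); apply: sumset_closed.
pose BR s := exists r, s = iota r.
pose V (j : 'I_(size F')) s := exists2 u, U u & s = phi F'`_j * iota u.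
(* The cyclic [R]-module on one translate of [x]; [N] lists those of [f], then those of [g]. *)
pose M x i s := exists r, s = iota r * phi F`_i * x.
pose N (i : 'I_(size F + size F)) :=
  match split i with inl j => M f j | inr j => M g j end.
have sV j : submodule BR (V j).
  have [_ [UB UM]] := sU; split; [|split].
  - by exists 0 => //; rewrite rmorph0 mulr0.
  - move=> _ _ [u Uu ->] [u' Uu' ->]; exists (u - u'); first exact: UB.
    by rewrite rmorphB mulrBr.
  - move=> _ _ [r ->] [u Uu ->]; exists (alpha (- F'`_j) r * u); first exact: UM.
    by rewrite rmorphM mulrA mul_term mulrA.
have sM x i : submodule BR (M x i).
  split; [|split].
  - by exists 0; rewrite rmorph0 !mul0r.
  - by move=> _ _ [r ->] [r' ->]; exists (r - r'); rewrite rmorphB !mulrBl.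
  - by move=> _ _ [r ->] [r' ->]; exists (r * r'); rewrite rmorphM !mulrA.
have nzM x i : x <> 0 -> nonzero (M x i).
  move=> nx; exists (phi F`_i * x); split; last by move=> /term_reg.
  by exists 1; rewrite rmorph1 mul1r.
have MV x i : (forall k, U (rc x k)) -> {subset supp x <= K} -> (i < size F)%N ->
    psubset (M x i) (sum_submodule V).
  move=> Ux xK iF _ [r ->]; set y := iota r * phi F`_i * x.
  have yF' k : rc y k <> 0 -> k \in F'.
    rewrite /y -mulrA rc_iotal rc_terml => nz.
    rewrite -(subrK F`_i k) addrC; apply: sumset_step; first exact: mem_nth.
    by apply: xK; rewrite mem_supp; apply: contra_notN nz => /eqP->; rewrite mulr0.
  exists (fun j => phi F'`_j * iota (rc y F'`_j)).
    move=> j; exists (rc y F'`_j) => //.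
    by rewrite /y -mulrA rc_iotal rc_terml; case: sU => _ [_]; apply.
  have [|k|_ _] := expansion_widen (l' := F') (rc_expansion y).
  - exact: sumset_uniq.
  - by rewrite mem_supp => /eqP; apply: yF'.
  - by move=> {1}->; rewrite (big_nth 0) big_mkord.
have iM x c (r : 'I_(size F) -> R) :
    (forall p, p * x = 0 <-> p * iota c = 0) ->
    \sum_j iota (r j) * phi F`_j * x = 0 ->
    forall j, iota (r j) * phi F`_j * x = 0.
  move=> xc; rewrite -mulr_suml => /xc; rewrite mulr_suml => e j; apply/xc.
  rewrite mul_term -mulrA -rmorphM; move: j.
  apply: (independent_terms (U := fullR) (sumset_uniq K n)) => [j|].
    by eexists; last reflexivity.
  rewrite -[RHS]e; apply: eq_bigr => j _.
  by rewrite mul_term -mulrA -rmorphM.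
have AM (r : 'I_(size F) -> R) : A (\sum_j iota (r j) * phi F`_j).
  apply: (big_ind A) => [|x y Ax Ay|j _]; first exact: term_span0.
    rewrite -[y]opprK; apply: term_span_sub => //; rewrite -sub0r.
    by apply: term_span_sub => //; apply: term_span0.
  by apply: term_span_mul; [exact: term_span_iota|exact/term_span_term/FT].
apply: (@uniform_exchange _ BR _ V _ N) => //.
- by move=> j; apply: uniform_term.
- exact: independent_terms (sumset_uniq K n.+1).
- by move=> i; rewrite /N; case: split.
- by move=> i; rewrite /N; case: split => j; apply: nzM.
- move=> i; rewrite /N; case: split => j; apply: MV => // k kx;
    by rewrite mem_cat kx ?orbT.
- move=> c Nc; rewrite big_split_ord /= => e.
  have /choice[r re] : forall j : 'I_(size F), M f j (c (lshift _ j)).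
    by move=> j; have := Nc (lshift _ j); rewrite /N (unsplitK (inl j)).
  have /choice[q qe] : forall j : 'I_(size F), M g j (c (rshift _ j)).
    by move=> j; have := Nc (rshift _ j); rewrite /N (unsplitK (inr j)).
  rewrite (eq_bigr _ (fun j _ => re j)) (eq_bigr _ (fun j _ => qe j)) in e.
  (* The relation equates an element of [L1] with one of [L2], so each half vanishes separately. *)
  have e1 : \sum_j iota (r j) * phi F`_j * f = 0.
    apply: disj; first by rewrite -mulr_suml; apply: L1M.
    move/eqP: e; rewrite addr_eq0 => /eqP->; rewrite -mulr_suml -mulNr -sumrN.
    apply: L2M => //; have := AM (fun j => - q j).
    by under eq_bigr do rewrite rmorphN mulNr.
  have e2 : \sum_j iota (q j) * phi F`_j * g = 0 by rewrite e1 add0r in e.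
  move=> i; case: (split_ordP i) => j ->; rewrite ?re ?qe.
    exact: (iM _ _ _ fa e1).
  exact: (iM _ _ _ gb e2).
Qed.

(* A f is isomorphic to A a for a suitable element a of R, by p f |-> p a. *)
Theorem enough_uniform_term_span : enough_uniform fullR -> enough_uniform A.
Proof.
move=> enR L lL [f0 [Lf0 nf0]]; have [LA [_ [LB LM]]] := lL.
have [r0 [a [nf fa]]] := cyclic_reduction nf0.
set f := iota r0 * f0 in nf fa.
have Lf : L f by apply: LM => //; apply: term_span_iota.
have na : a <> 0.
  by move=> a0; apply: nf; rewrite -[f]mul1r; apply/fa; rewrite a0 rmorph0 mulr0.
(* A uniform [U] inside [R a] has a uniform extension inside [A a]; the ideal exhibited below is its
   transport to [A f]. *)
have [U [unU Ua]] := enR _ (principal_left_ideal a) (principal_nonzero na).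
have [lU [[u [Uu nu]] _]] := unU; have U0 := lU.2.1.
have [[_ [X0 [XB XM]]] [_ unX]] := ext_ideal_uniform unU.
have fa_eq p q : p * f = q * f <-> p * iota a = q * iota a.
  split=> /eqP; rewrite -subr_eq0 -mulrBl => /eqP/fa; rewrite mulrBl.
    by move=> /subr0_eq.
  by move=> /subr0_eq.
exists (fun s => exists p, [/\ A p, s = p * f & ext_ideal U (p * iota a)]).
split; last by move=> _ [p [Ap -> _]]; apply: LM.
split; [split; [|split; [|split]]|split].
- by move=> _ [p [Ap -> _]]; apply/LA/LM.
- by exists 0; rewrite !mul0r; split=> //; apply: term_span0.
- move=> _ _ [p [Ap -> Xp]] [q [Aq -> Xq]]; exists (p - q); rewrite !mulrBl.
  by split=> //; [apply: term_span_sub|apply: XB].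
- move=> b _ Ab [p [Ap -> Xp]]; exists (b * p); rewrite -!mulrA.
  by split=> //; [apply: term_span_mul|apply: XM].
- have [r ur] := Ua _ Uu; exists (iota r * f); split.
    exists (iota r); split=> //; first exact: term_span_iota.
    by rewrite -rmorphM -ur; apply: ext_ideal_iota.
  by move=> /fa; rewrite -rmorphM -ur => /iota_eq0.
move=> L1 L2 lL1 lL2 nz1 nz2 L1W L2W.
(* Transport from [A f] to [A a], where uniformity of the extension of [U] applies. *)
pose push (L' : S -> Prop) s := exists p, [/\ A p, s = p * iota a & L' (p * f)].
have lpush L' : left_ideal A L' -> left_ideal A (push L').
  move=> [_ [L0' [LB' LM']]]; split; [|split; [|split]].
  - by move=> _ [p [Ap -> _]]; apply: term_span_mul => //; apply: term_span_iota.
  - by exists 0; rewrite !mul0r; split=> //; apply: term_span0.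
  - move=> _ _ [p [Ap -> Lp]] [q [Aq -> Lq]]; exists (p - q); rewrite !mulrBl.
    by split=> //; [apply: term_span_sub|apply: LB'].
  - move=> b _ Ab [p [Ap -> Lp]]; exists (b * p); rewrite -!mulrA.
    by split=> //; [apply: term_span_mul|apply: LM'].
have nzpush L' : psubset L' (fun s => exists p,
    [/\ A p, s = p * f & ext_ideal U (p * iota a)]) ->
    nonzero L' -> nonzero (push L').
  move=> LW [x [Lx nx]]; have [p [Ap xe _]] := LW _ Lx; exists (p * iota a).
  split; first by exists p; rewrite -xe.
  by move=> /fa; rewrite -xe.
have subpush L' : psubset L' (fun s => exists p,
    [/\ A p, s = p * f & ext_ideal U (p * iota a)]) ->
    psubset (push L') (ext_ideal U).
  move=> LW _ [p [Ap -> /LW[q [Aq /fa_eq e Xq]]]]; by rewrite e.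
have [s [[[p [Ap se L1p]] [q [Aq se' L2q]]] ns]] := unX _ _ (lpush _ lL1)
  (lpush _ lL2) (nzpush _ L1W nz1) (nzpush _ L2W nz2) (subpush _ L1W) (subpush _ L2W).
exists (p * f); split; last by move=> /fa; rewrite -se.
split=> //; suff -> : p * f = q * f by [].
by apply/fa_eq; rewrite -se.
Qed.

Lemma has_indep_ext_ideal I : has_indep fullR I -> has_indep A I.
Proof.
move=> [L [lL indL]]; exists (fun i => ext_ideal (L i)); split.
  move=> i; have [li nzi] := lL i; split; first exact: ext_ideal_left_ideal.
  by apply: ext_ideal_nonzero => //; have [_ []] := li.
move=> n f a fI La e k; apply: rc_eq0 => g.
apply: (indL n f (fun k => rc (a k) g) fI).
  by move=> j; case: (La j).
by rewrite -rc_sum e rc0.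
Qed.

(** * Bounding independent families of [A] by uniform elements of [R] *)

Section UniformBasis.
Variable K : R -> Prop.
Hypothesis K_uniform : forall k, K k -> uniform_element k.
Hypothesis K_independent : left_independent K.
Hypothesis K_essential : essential_left_ideal fullR (left_span K).

Local Notation ext k := (ext_ideal (fun x => exists r, x = r * k)).

Let ext_submodule k : submodule A (ext k).
Proof. by have [] := ext_ideal_left_ideal (principal_left_ideal k). Qed.

Let finite_sum (F : {fset R}) (s : S) : Prop :=
  (forall k, k \in F -> K k) /\
  exists2 v : R -> S, forall k, ext k (v k) & s = \sum_(k <- F) v k.

Let finite_sum_widen (F F' : {fset R}) s : (F `<=` F')%fset ->
  (exists2 v : R -> S, forall k, ext k (v k) & s = \sum_(k <- F) v k) ->
  exists2 v : R -> S, forall k, ext k (v k) & s = \sum_(k <- F') v k.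
Proof.
move=> FF' [v Xv ->]; exists (fun k => if k \in F then v k else 0).
  by move=> k; case: ifP => // _; case: (ext_submodule k).
rewrite -(big_fset_incl _ FF'); last by move=> k _ /negPf->.
by apply: eq_big_seq => k ->.
Qed.

Let finite_sumD F F' s s' : finite_sum F s -> finite_sum F' s' ->
  finite_sum (F `|` F')%fset (s + s').
Proof.
move=> [FK sF] [FK' sF']; split.
  by move=> k; rewrite in_fsetU => /orP[/FK|/FK'].
have [v Xv ->] := finite_sum_widen (fsubsetUl F F') sF.
have [v' Xv' ->] := finite_sum_widen (fsubsetUr F F') sF'.
exists (fun k => v k + v' k); last by rewrite big_split.
by move=> k; apply: submoduleD.
Qed.

Let finite_sum_exists s : ext_ideal (left_span K) s -> exists F, finite_sum F s.
Proof.
move=> [As Ks].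
have fin0 : exists F, finite_sum F 0.
  exists fset0; split=> //; exists (fun=> 0); first by move=> k; case: (ext_submodule k).
  by rewrite big_seq_fset0.
have finD x y : (exists F, finite_sum F x) -> (exists F, finite_sum F y) ->
    exists F, finite_sum F (x + y).
  by move=> [F ?] [F' ?]; exists (F `|` F')%fset; apply: finite_sumD.
rewrite (rcE s) big_seq; apply: (big_ind (fun s => exists F, finite_sum F s)) => //.
move=> g; rewrite mem_supp => /eqP gs.
have Tg : T g by move: As gs => /in_term_span; apply.
elim: (Ks g) => [|r k x Kk _ IH]; first by rewrite rmorph0 mulr0.
rewrite rmorphD mulrDr; apply: finD => //; exists [fset k]%fset; split.
  by move=> ?; rewrite in_fset1 => /eqP->.
exists (fun k' => if k' == k then phi g * iota (r * k) else 0); last first.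
  by rewrite big_seq_fset1 eqxx.
move=> k'; case: eqP => [->|_]; last by case: (ext_submodule k').
split.
  by apply: term_span_mul; [exact: term_span_term|exact: term_span_iota].
move=> h; rewrite rc_term; case: eqP => _; first by exists r.
by exists 0; rewrite mul0r.
Qed.

(** At each degree the coefficients form a relation among members of [K]. *)
Let ext_independent (F : {fset R}) : (forall k, k \in F -> K k) ->
  independent (fun j : 'I_(size F) => ext (nth 0 F j)).
Proof.
move=> FK a Xa e j; apply: rc_eq0 => g.
have /choice[c ce] : forall j, exists r, rc (a j) g = r * nth 0 F j.
  by move=> i; case: (Xa i).
rewrite ce; move: j.
apply: (K_independent (f := fun j : 'I_(size F) => nth 0 F j) (c := c)).
- by move=> i j /eqP; rewrite nth_uniq ?fset_uniq // => /eqP/val_inj.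
- by move=> i; apply/FK/mem_nth.
- rewrite -[RHS](rc0 g) -e rc_sum; apply: eq_bigr => i _; by rewrite ce.
Qed.

(* Each member of an independent family contains a non-zero element of a finite
   sum of the uniform ideals A k; by the exchange theorem Hall's condition holds
   for the finite index sets of these sums. *)
Lemma indep_card_le I : has_indep A I -> card_le I {k | K k}.
Proof.
move=> [L [lL indL]].
have /choice[F FP] : forall i, exists F, exists2 s, L i s /\ s <> 0 & finite_sum F s.
  move=> i; have [[LA [_ [_ LM]]] [f [Lf nf]]] := lL i.
  have [r nrf Er] := essential_multiple K_essential nf.
  have Lrf : L i (iota r * f) by apply: LM => //; apply: term_span_iota.
  have [|F FP] := finite_sum_exists (s := iota r * f).
    by split=> //; apply: LA.
  by exists F, (iota r * f).
have FK i k : k \in F i -> K k by have [s _ [h _]] := FP i; apply: h.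
(* [classic] gives the arbitrary index type [I] the choice structure that Hall's theorem asks
   for. *)
have [J|f fI fF] := @hall_transversal {classic I} _ F; last first.
  exists (fun i => exist K (f i) (FK i _ (fF i))) => i j [] /fI //.
set W := (\bigcup_(i <- J) F i)%fset.
have WK k : k \in W -> K k.
  by move=> /bigfcupP[i _]; apply: FK.
pose V (j : 'I_(size W)) := ext (nth 0 W j).
have sV j : submodule A (V j) by apply: ext_submodule.
pose x0 (j : 'I_(size J)) : I := tnth (in_tuple J) j.
pose N (j : 'I_(size J)) s := L (x0 j) s /\ sum_submodule V s.
apply: (@uniform_exchange _ A _ V _ N) => //.
- move=> j; have kK : K (nth 0 W j) by apply/WK/mem_nth.
  have [_ [_ unV]] := ext_ideal_uniform (K_uniform kK).
  move=> L1 L2 sL1 sL2 nz1 nz2 L1V L2V; apply: unV => //.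
    by split=> // s /L1V[].
  by split=> // s /L2V[].
- exact: ext_independent.
- move=> j; apply: submoduleI; last exact: submodule_sum_submodule.
  by have [[]] := lL (x0 j).
- move=> j; have [s [Ls ns] [_ sF]] := FP (x0 j); exists s; split=> //; split=> //.
  have FW : (F (x0 j) `<=` W)%fset.
    by apply: (@bigfcup_sup _ {classic I} J _ xpredT) => //; apply: mem_tnth.
  have [v Xv ->] := finite_sum_widen FW sF.
  exists (fun j => v (nth 0 W j)) => [i|]; first exact: Xv.
  by rewrite (big_nth 0) big_mkord.
- by move=> j s [].
- move=> a Na e j; apply: (indL _ x0 a) => //; last by move=> k; case: (Na k).
  have /tuple_uniqP xI : uniq (in_tuple J) by apply: fset_uniq.
  exact: xI.
Qed.

Lemma has_indep_uniform_basis : has_indep fullR {k | K k}.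
Proof.
exists (fun k x => exists r, x = r * sval k); split.
  move=> [k Kk] /=; split; first exact: principal_left_ideal.
  by have [_ []] := K_uniform Kk.
move=> n f a fI /choice[c ae] e k; rewrite ae; move: k.
apply: (K_independent (f := fun i => sval (f i))).
- move=> i j h; apply: fI; move: h; case: (f i) => x Kx; case: (f j) => y Ky.
  exact: eq_exist.
- by move=> i; case: (f i).
- by rewrite -[RHS]e; apply: eq_bigr => i _; rewrite ae.
Qed.

End UniformBasis.

(** The set [K] depends on [R] alone and bounds every independent family of [A]; the other
    inequality extends left ideals of [R]. *)
Theorem udim_eq_term_span : enough_uniform fullR -> udim_eq A fullR.
Proof.
move=> enR; split; apply: udim_le_card => I; last first.
  by move=> hI; exists I; split; [exact: has_indep_ext_ideal|exists id].
have [K [unK indK essK]] := essential_uniform_elements enR.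
move=> hI; exists {k | K k}; split; last exact: indep_card_le hI.
exact: has_indep_uniform_basis.
Qed.

(** * Denominators and rings of fractions *)

Lemma diff_group0 : diff_group T 0.
Proof. by case: T_monoid => T0 _; exists 0, 0; rewrite subr0. Qed.

Lemma diff_groupB g h : diff_group T g -> diff_group T h -> diff_group T (g - h).
Proof.
have [_ TD] := T_monoid.
move=> [a [b [Ta [Tb ->]]]] [c [d [Tc [Td ->]]]]; exists (a + d), (b + c).
by split; [exact: TD|split; [exact: TD|rewrite opprB addrACA opprD]].
Qed.

Local Notation frac := (term_span iota phi (fun=> True) (diff_group T)).

Lemma diff_group_monoid : is_submonoid (diff_group T).
Proof.
split; first exact: diff_group0.
move=> g h Gg Gh; rewrite -[h]opprK; apply: diff_groupB => //; rewrite -sub0r.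
by apply: diff_groupB => //; apply: diff_group0.
Qed.

Lemma sub_diff_group t : T t -> diff_group T t.
Proof. by case: T_monoid => T0 _ Tt; exists t, 0; rewrite subr0. Qed.

Lemma term_span_frac s : A s -> frac s.
Proof.
by move=> /in_term_span As; apply/in_term_span => g /As; apply: sub_diff_group.
Qed.

(** Each degree of [q] is a difference [a - b]; the sum of the finitely many [b] clears them all, on
    either side since [G] is commutative. *)
Lemma common_denominator q : frac q ->
  exists2 t, T t & A (phi t * q) /\ A (q * phi t).
Proof.
have [T0 TD] := T_monoid; move=> /in_term_span hq.
have [t Tt tq] : exists2 t, T t & forall g, g \in supp q -> T (g + t).
  have: forall g, g \in supp q -> diff_group T g.
    by move=> g; rewrite mem_supp => /eqP/hq.
  elim: (supp q) => [|g l IH] hl; first by exists 0.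
  have [h hh|t Tt tl] := IH; first by apply: hl; rewrite inE hh orbT.
  have [a [b [Ta [Tb ge]]]] := hl g (mem_head _ _).
  exists (b + t); first exact: TD.
  move=> h; rewrite inE => /orP[/eqP->|/tl Th].
    by rewrite ge addrA subrK; apply: TD.
  by rewrite addrCA; apply: TD.
exists t => //; split; apply/in_term_span => g.
  rewrite rc_terml => /eqP; rewrite -mem_supp => /tq.
  by rewrite subrK.
move=> /rc_mul_neq0[h [/eqP]]; rewrite -mem_supp => /tq Tht.
rewrite -[phi t]mulr1 -(rmorph1 iota) rc_term; case: eqP => // ght _.
by rewrite -(subrK h g) ght addrC.
Qed.

(** Conjugation by a term twists coefficients but keeps supports, as [G] is commutative, so it
    preserves [A]; both Ore conditions then hold with the given denominator itself. *)
Theorem denominator_set_term_span :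
  denominator_set A (fun s => exists t, T t /\ s = phi t).
Proof.
have [T0 TD] := T_monoid.
have conj t s : T t -> A s -> A (phi t * s * phi (- t)) /\ A (phi (- t) * s * phi t).
  have cj u g a : phi u * (phi g * iota a) * phi (- u) = phi g * iota (alpha u a).
    by rewrite mulrA -!termD -mulrA mul_term opprK mulrA -termD addrAC subrr add0r.
  move=> Tt /in_term_span As; split; apply/in_term_span => k.
    rewrite {1}(rcE s) mulr_sumr mulr_suml rc_sum; apply: contra_notP => nTk.
    rewrite big_seq big1 // => g; rewrite mem_supp => /eqP gs.
    by rewrite cj rc_term; case: eqP => // kg; case: nTk; rewrite kg; apply: As.
  rewrite {1}(rcE s) mulr_sumr mulr_suml rc_sum; apply: contra_notP => nTk.
  rewrite big_seq big1 // => g; rewrite mem_supp => /eqP gs.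
  rewrite -{2}[t]opprK cj rc_term; case: eqP => // kg.
  by case: nTk; rewrite kg; apply: As.
split; [|split; [|split; [|split; [|split]]]].
- by move=> _ [t [Tt ->]]; apply: term_span_term.
- by exists 0; rewrite term0.
- by move=> _ _ [t [Tt ->]] [u [Tu ->]]; exists (t + u); rewrite termD; split=> //; apply: TD.
- by move=> _ [t [Tt ->]] b _; split; [apply: reg_term|apply: term_reg].
- move=> b _ Ab [t [Tt ->]]; exists (phi t * b * phi (- t)), (phi t).
  split; first by have [] := conj t b Tt Ab.
  split; first by exists t.
  by rewrite -mulrA termVl mulr1.
- move=> b _ Ab [t [Tt ->]]; exists (phi (- t) * b * phi t), (phi t).
  split; first by have [] := conj t b Tt Ab.
  split; first by exists t.
  by rewrite !mulrA termVr mul1r.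
Qed.

End Extension.

Section Fractions.
Variable T : G -> Prop.
Hypothesis T_monoid : is_submonoid T.
Local Notation A := (term_span iota phi (fun=> True) T).
Local Notation frac := (term_span iota phi (fun=> True) (diff_group T)).

Theorem ring_of_fractions_term_span :
  ring_of_fractions A (fun s => exists t, T t /\ s = phi t) frac.
Proof.
have [T0 TD] := T_monoid.
split; first exact/term_span_subring/diff_group_monoid.
split; first by move=> s; apply: term_span_frac.
split; [|split].
- move=> _ [t [Tt ->]]; exists (phi (- t)); rewrite termVl termVr; split=> //.
  apply/term_span_term; exists 0, t; by rewrite sub0r.
- move=> q /(common_denominator T_monoid)[t Tt [At _]].
  exists (phi t), (phi (- t)), (phi t * q); rewrite mulrA termVl termVr mul1r.
  by split=> //; exists t.
- move=> q /(common_denominator T_monoid)[t Tt [_ At]].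
  exists (phi t), (phi (- t)), (q * phi t); rewrite -mulrA termVl termVr mulr1.
  by split=> //; exists t.
Qed.

(** A left ideal of [A] passes to the fractions that some [phi t] multiplies into it, and one of the
    ring of fractions comes back by intersection with [A]. Index sets are kept, since a finite
    relation is cleared by one common [t]. *)
Theorem udim_eq_fractions : udim_eq A frac.
Proof.
have [T0 TD] := T_monoid; have fm := diff_group_monoid T_monoid.
split; apply: udim_le_card => I [L [lL indL]]; exists I; (split; last by exists id).
  exists (fun i s => frac s /\ exists2 t, T t & L i (phi t * s)); split.
    move=> i; have [[LA [L0 [LB LM]]] [x [Lx nx]]] := lL i.
    have Lphi t s : T t -> L i s -> L i (phi t * s).
      by move=> Tt; apply/LM/term_span_term.
    split; last first.
      exists x; split=> //; split; first exact/term_span_frac/LA.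
      by exists 0; rewrite // term0 mul1r.
    split; first by move=> s [].
    split; first by split; [exact: term_span0|exists 0; rewrite ?mulr0].
    split.
      move=> s s' [fs [t Tt Lt]] [fs' [t' Tt' Lt']].
      split; first exact: term_span_sub.
      exists (t + t'); first exact: TD.
      rewrite mulrBr; apply: LB; last by rewrite termD -mulrA; apply: Lphi.
      by rewrite addrC termD -mulrA; apply: Lphi.
    move=> b s fb [fs [t Tt Lt]]; split; first exact: term_span_mul.
    (* The product [b * s] is read as [(b * phi (- t)) * (phi t * s)], and a denominator of the
       first factor brings that factor into [A]. *)
    have fbt : frac (b * phi (- t)).
      apply: term_span_mul => //; apply: term_span_term; exists 0, t.
      by rewrite sub0r.
    have [u Tu [Au _]] := common_denominator T_monoid fbt; exists u => //.
    have -> : phi u * (b * s) = phi u * (b * phi (- t)) * (phi t * s).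
      by rewrite -!mulrA [phi (- t) * _]mulrA termVl mul1r.
    exact: LM.
  move=> n f a fI La e k.
  have [t Tt Lt] : exists2 t, T t & forall k, L (f k) (phi t * a k).
    suff [t Tt tP] : exists2 t, T t &
        forall k, k \in enum 'I_n -> L (f k) (phi t * a k).
      by exists t => // j; apply: tP; rewrite mem_enum.
    elim: (enum 'I_n) => [|j l [t Tt tl]]; first by exists 0.
    have [_ [u Tu Lu]] := La j; exists (t + u); first exact: TD.
    have LM i : forall b x, A b -> L i x -> L i (b * x).
      by have [[_ [_ [_]]]] := lL i.
    move=> h; rewrite inE => /orP[/eqP->|/tl Lh].
      by rewrite termD -mulrA; apply: LM => //; apply: term_span_term.
    by rewrite addrC termD -mulrA; apply: LM => //; apply: term_span_term.
  apply: (@term_reg t); apply: (indL n f (fun k => phi t * a k)) => //.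
  by rewrite -mulr_sumr e mulr0.
exists (fun i s => L i s /\ A s); split.
  move=> i; have [[LA [L0 [LB LM]]] [x [Lx nx]]] := lL i; split.
    split; first by move=> s [].
    split; first by split=> //; apply: term_span0.
    split.
      by move=> s s' [? ?] [? ?]; split; [apply: LB|apply: term_span_sub].
    move=> b s Ab [Ls As]; split; last exact: term_span_mul.
    by apply: LM => //; apply: term_span_frac.
  have [t Tt [At _]] := common_denominator T_monoid (LA _ Lx).
  exists (phi t * x); split; last by move=> /term_reg.
  by split=> //; apply: LM => //; apply/term_span_frac/term_span_term.
by move=> n f a fI La; apply: (indL n f a) => // k; case: (La k).
Qed.

End Fractions.

End Ordered.
End SkewRing.

(** * The polynomial ring on a basis of the group of differences *)

Lemma monoid_gen_submonoid (G : zmodType) (B : G -> Prop) :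
  is_submonoid (monoid_gen B).
Proof.
split; first by exists [::]; rewrite big_nil.
move=> g h [s [sB ->]] [s' [sB' ->]]; exists (s ++ s'); rewrite big_cat; split=> //.
by move=> x; rewrite mem_cat => /orP[/sB|/sB'].
Qed.

(** Makes the localisation results apply to the polynomial ring on [X'], whose ring of fractions is
    then that of [A]. *)
Lemma diff_group_monoid_gen (G : zmodType) (H B : G -> Prop) :
  H 0 -> (forall a b, H a -> H b -> H (a - b)) -> is_Zbasis H B ->
  diff_group (monoid_gen B) = H.
Proof.
move=> H0 HB /is_ZbasisP[BH spB _].
have mB := monoid_gen_submonoid B; apply/funext => g; apply/propext; split.
  have genH h : monoid_gen B h -> H h.
    move=> [s [sB ->]]; apply: (zspan_sub (Y := H)) => //.
    have -> : \sum_(x <- s) x = \sum_(x <- s) x *~ 1.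
      by apply: eq_bigr => x _; rewrite mulr1z.
    by apply: zspan_sum => x /sB/BH; apply: zspan_gen.
  by move=> [a [b [/genH Ha [/genH Hb ->]]]]; apply: HB.
move=> /spB; apply: zspan_sub; first exact: diff_group0.
  by move=> a b; apply: diff_groupB.
move=> b Bb; apply: sub_diff_group => //; exists [:: b]; rewrite big_seq1.
by split=> // x; rewrite inE => /eqP->.
Qed.

Theorem mainTheorem5
  (R : pzRingType) (G : zmodType) (X : G -> Prop)
  (alpha : G -> {rmorphism R -> R})
  (S : pzRingType) (iota : {rmorphism R -> S}) (phi : G -> S)
  (T : G -> Prop) :
  (exists x, X x) ->
  is_Zbasis (fun _ => True) X ->
  aut_action alpha ->
  is_skew_group_ring alpha iota phi ->
  is_submonoid T ->
  let A := term_span iota phi (fun _ => True) T in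
  let Tphi := fun s => exists t, T t /\ s = phi t in
  let G' := diff_group T in
  let S' := term_span iota phi (fun _ => True) G' in
  denominator_set A Tphi /\
  ring_of_fractions A Tphi S' /\
  (exists X' : G -> Prop,
     is_Zbasis G' X' /\
     udim_eq A S' /\
     udim_eq S' (term_span iota phi (fun _ => True) (monoid_gen X'))) /\
  (forall s, left_singular A s <-> term_span iota phi (left_singular (fun _ : R => True)) T s) /\
  (enough_uniform (fun _ : R => True) ->
     enough_uniform A /\ udim_eq A (fun _ : R => True)).
Proof.
move=> _ basisX alphaP SP T_monoid A Tphi G' S'.
have [P P_cone P_total] := torsion_free_orderable (zbasis_torsion_free basisX).
have G'0 : G' 0 by apply: diff_group0.
have G'B a b : G' a -> G' b -> G' (a - b) by apply: diff_groupB.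
split; first exact: (denominator_set_term_span alphaP SP T_monoid).
split; first exact: (ring_of_fractions_term_span alphaP SP T_monoid).
split; last first.
  split; first exact: (left_singular_term_span alphaP SP P_cone P_total T_monoid).
  move=> enR; split.
    exact: (enough_uniform_term_span alphaP SP P_cone P_total T_monoid enR).
  exact: (udim_eq_term_span alphaP SP P_cone P_total T_monoid enR).
have [X' basisX'] := subgroup_free basisX G'0 G'B; exists X'; split=> //.
split; first exact: (udim_eq_fractions alphaP SP T_monoid).
(* The localisation statement at the monoid generated by [X'], read in the opposite direction once
   its group of differences is rewritten as [G']. *)
have [le1 le2] := udim_eq_fractions alphaP SP (monoid_gen_submonoid X').
by rewrite (diff_group_monoid_gen G'0 G'B basisX') in le1 le2.
Qed.
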